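(* For every trade-off parameter $s \in (0,1]$, define \[ \rho(s):=\frac{e^s}{s} \quad\text{and}\quad \chi(s):=\begin{cases} (e^s-1)/s, & 0< s < \ln 2, \\ \xi(s)/s, & \ln 2 \leq s \leq 1, \end{cases} \] where, for $s\in[\ln 2,1]$, $\xi(s)$ is the unique solution $\xi\in[1,e]$ of $\xi(2-\ln \xi)=e^s$. Then for every $s\in(0,1]$ there exists a randomized $\rho(s)$-robust $\chi(s)$-consistent online bidding algorithm (strategy). Moreover, the pair $(\rho(s),\chi(s))$ is Pareto-optimal: there is no $\rho'$-robust $\chi(s)$-consistent randomized strategy with $\rho'<\rho(s)$.
   Context: Online bidding: there is an unknown target $T>0$; a bidder submits strictly increasing positive bids until a bid of value at least $T$ is submitted; the cost is the sum of all submitted bids up to and including the first bid $\ge T$. A prediction $P>0$ of $T$ is given; by scale invariance it is normalized to $P=1$. Algorithms are modeled by strategies: a deterministic strategy is a bi-infinite sequence $b=(b_n)_{n\in\mathbb{Z}}$ with $0<\cdots<b_{-1}<b_0<b_1<\cdots$, and its cost on target $T>0$ is $\mathrm{cost}_b(T):=\sum_{n\le n_*} b_n$ where $n_*:=\min\{n\in\mathbb{Z}: b_n\ge T\}$. A randomized strategy $B$ is a probability distribution over deterministic strategies, and $\mathrm{cost}_B(T)$ denotes its expected cost. $B$ is $\chi$-consistent if $\mathrm{cost}_B(1)\le \chi$ and $\rho$-robust if $\mathrm{cost}_B(T)\le \rho T$ for every $T>0$. A pair $(\rho,\chi)$ is Pareto-optimal if there is a $\rho$-robust $\chi$-consistent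 strategy but no $\rho'$-robust $\chi$-consistent strategy for any $\rho'<\rho$. *)

(* Defs.v *)
From HB Require Import structures.
From mathcomp Require Import all_boot all_order all_algebra.
From mathcomp Require Import all_classical all_reals all_analysis.
Set Implicit Arguments. Unset Strict Implicit. Unset Printing Implicit Defensive.
Import Order.TTheory GRing.Theory Num.Theory.
Local Open Scope classical_set_scope.
Local Open Scope ring_scope.

Section OnlineBidding.
Context {R : realType}.

Definition strategy (b : int -> R) : Prop :=
  (forall n : int, 0 < b n) /\ (forall n : int, b n < b (n + 1)).

(* n_* := min { n : b_n >= T } (picked classically; meaningful when it exists) *)
Definition is_nstar (b : int -> R) (T : R) (n : int) : Prop :=
  T <= b n /\ (forall m : int, T <= b m -> n <= m).

Definition nstar (b : int -> R) (T : R) : int := xget 0 (is_nstar b T).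

Definition cost (b : int -> R) (T : R) : \bar R :=
  if `[< exists n, is_nstar b T n >]
  then (\esum_(n in [set n : int | (n <= nstar b T)%R]) (b n)%:E)%E
  else +oo%E.

Definition rand_strategy {d} {Omega : measurableType d}
  (b : Omega -> int -> R) : Prop :=
  (forall w, strategy (b w)) /\
  (forall n : int, measurable_fun setT (fun w => b w n)).

Definition rand_cost {d} {Omega : measurableType d} (P : probability Omega R)
  (b : Omega -> int -> R) (T : R) : \bar R :=
  (\int[P]_w cost (b w) T)%E.

Definition robust {d} {Omega : measurableType d} (P : probability Omega R)
  (b : Omega -> int -> R) (rho : R) : Prop :=
  forall T : R, 0 < T -> (rand_cost P b T <= (rho * T)%:E)%E.

Definition consistent {d} {Omega : measurableType d} (P : probability Omega R)
  (b : Omega -> int -> R) (chi : R) : Prop :=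
  (rand_cost P b 1 <= chi%:E)%E.

Definition rho_s (s : R) : R := expR s / s.

Definition xi_s (s : R) : R :=
  xget 1 [set x : R | 1 <= x <= expR 1 /\ x * (2 - ln x) = expR s].

Definition chi_s (s : R) : R :=
  if s < ln 2 then (expR s - 1) / s else xi_s s / s.

End OnlineBidding.

(* Main.v *)
Require Import Defs.
From mathcomp Require Import all_boot all_order all_algebra.
From mathcomp Require Import all_classical all_reals all_analysis.
From mathcomp Require Import measurable_realfun zify ring lra.
Import Order.TTheory GRing.Theory Num.Theory.
Import numFieldNormedType.Exports.
Local Open Scope classical_set_scope.
Local Open Scope ring_scope.
Set Implicit Arguments.
Unset Strict Implicit.
Unset Printing Implicit Defensive.

(* Index the bids of a randomized strategy by their expected rank and let [H t]
   be the expected total of the bids of rank at most [t]. Then [H' t] is the bid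
   of rank [t], the expected cost on target [H' t] is at least [H (t + 1)], with
   equality for the strategy bidding [H' (n + U)], [U] uniform on [0, 1].
   So [rho]-robustness is the delay inequality [H (t + 1) <= rho * H' t], and if
   rank [0] corresponds to the bid [1] the consistency is [H 1].

   For [rho = e^s / s] the inequality forces [H' >= s H], and then
   [I t = e^(- s t) H t - s (integral of e^(- s u) H u over [t, t + 1])]
   is nondecreasing and nonnegative. [I 0 >= 0] reads
   [e^(- s) H 1 >= integral of e^(- s u) H' u over [0, 1]], where both
   [H' u >= 1] and [H' u >= s e^(- s) H (u + 1) >= s e^(s (u - 1)) H 1]; using
   the former up to a rank [tau] and the latter beyond, the best [tau] gives
   [H 1 >= chi_s s]. As the [H] of a strategy is only convex, the argument is
   run on its means over short intervals, the slack [rho' < rho] making the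
   inequality strict.

   Equality forces [H' u = max 1 (e^(s (u - tau)))] for [u >= 0] and the delay
   equation [H' t = H (t + 1) / rho] for [t < 0], which is solved backwards in
   pieces of length one; [I = 0] keeps the solution positive. *)

Section PointwiseDerivatives.
Context {R : realType}.
Implicit Types (F G : R -> R) (a b k x : R).

Lemma is_derive_addfun F G a b x : is_derive x 1 F a -> is_derive x 1 G b ->
  is_derive x 1 (fun y => F y + G y) (a + b).
Proof. exact: is_deriveD. Qed.

Lemma is_derive_subfun F G a b x : is_derive x 1 F a -> is_derive x 1 G b ->
  is_derive x 1 (fun y => F y - G y) (a - b).
Proof. exact: is_deriveB. Qed.

Lemma is_derive_mulfun F G a b x : is_derive x 1 F a -> is_derive x 1 G b ->
  is_derive x 1 (fun y => F y * G y) (F x * b + G x * a).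
Proof. exact: is_deriveM. Qed.

Lemma is_derive_cstfun k x : is_derive x 1 (fun=> k) 0.
Proof. exact: is_derive_cst. Qed.

Lemma is_derive_idfun x : is_derive x 1 (fun y => y) 1.
Proof. exact: is_derive_id. Qed.

Lemma is_derive_expR_comp F a x : is_derive x 1 F a ->
  is_derive x 1 (fun y => expR (F y)) (expR (F x) * a).
Proof. by move=> dF; exact: is_derive1_comp. Qed.

Lemma is_derive_comp_shift F a k x : is_derive (x + k) 1 F a ->
  is_derive x 1 (fun y => F (y + k)) a.
Proof.
move=> dF; rewrite -[a]mulr1.
exact: (@is_derive1_comp _ F (shift k) x a 1 dF (is_derive_shift x 1 k)).
Qed.

End PointwiseDerivatives.

(* Priority 0 puts these rules before the library ones, which leave [*:] in the
   result. They are triggered by [refine (is_derive_eq _ _)]: [apply:] would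
   start the resolution before the function to differentiate is known. *)
#[local] Existing Instances is_derive_addfun is_derive_subfun is_derive_mulfun
  is_derive_cstfun is_derive_idfun is_derive_expR_comp | 0.

Section DerivativeComparison.
Context {R : realType}.
Implicit Types (f g F G : R -> R) (a b x m : R).

Lemma is_derive_continuous f F :
  (forall x, is_derive x 1 F (f x)) -> continuous F.
Proof.
by move=> dF x; apply/differentiable_continuous/derivable1_diffP; case: (dF x).
Qed.

Lemma is_derive_MVT f F a b : a < b ->
    (forall x, a <= x <= b -> is_derive x 1 F (f x)) ->
  exists2 c, a < c < b & F b - F a = f c * (b - a).
Proof.
move=> ab dF; have [| |c] := @MVT R F f a b ab.
- by move=> x; rewrite in_itv /= => /andP[ax xb]; apply: dF; rewrite !ltW.
- apply: derivable_within_continuous => x; rewrite in_itv /= => /dF xab.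
  exact: ex_derive.
- by rewrite in_itv /= => cab ->; exists c.
Qed.

Lemma is_derive_lt f F a b : a < b -> (forall x, is_derive x 1 F (f x)) ->
  (forall x, a < x < b -> 0 < f x) -> F a < F b.
Proof.
move=> ab dF f0; have [c cab FE] := is_derive_MVT ab (fun x _ => dF x).
by rewrite -subr_gt0 FE mulr_gt0 ?f0 // subr_gt0.
Qed.

Lemma is_derive_le f F a b : a <= b -> (forall x, is_derive x 1 F (f x)) ->
  (forall x, a < x < b -> 0 <= f x) -> F a <= F b.
Proof.
rewrite le_eqVlt => /predU1P[-> //|ab] dF f0.
have [c cab FE] := is_derive_MVT ab (fun x _ => dF x).
by rewrite -subr_ge0 FE mulr_ge0 ?f0 // subr_ge0 ltW.
Qed.

Lemma is_derive_le_sub f g F G a b : a <= b ->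
    (forall x, a <= x <= b -> is_derive x 1 F (f x)) ->
    (forall x, a <= x <= b -> is_derive x 1 G (g x)) ->
    (forall x, a < x < b -> f x <= g x) ->
  F b - F a <= G b - G a.
Proof.
rewrite le_eqVlt => /predU1P[-> *|ab dF dG fg]; first by rewrite !subrr.
have [|c cab GFE] :=
    @is_derive_MVT (fun x => g x - f x) (fun x => G x - F x) a b ab.
  by move=> x xab; exact: (is_derive_subfun (dG _ xab) (dF _ xab)).
have : 0 <= (g c - f c) * (b - a) by rewrite mulr_ge0 ?subr_ge0 ?fg // ltW.
by rewrite -GFE; lra.
Qed.

Lemma is_derive_eq_sub f g F G a b : a <= b ->
    (forall x, a <= x <= b -> is_derive x 1 F (f x)) ->
    (forall x, a <= x <= b -> is_derive x 1 G (g x)) ->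
    (forall x, a < x < b -> f x = g x) ->
  F b - F a = G b - G a.
Proof.
move=> ab dF dG fg; apply: le_anti.
rewrite (is_derive_le_sub ab dF dG) => [|x /fg->//].
by rewrite (is_derive_le_sub ab dG dF) // => x /fg->.
Qed.

Lemma is_derive_slope_ge F a x m : is_derive x 1 F a ->
  (forall d, 0 < d -> d * m <= F (x + d) - F x) -> m <= a.
Proof.
move=> [dF <-] slope; apply: (cvgr_to_ge (cvg_dnbhs_at_right dF)); near=> d.
have d0 : 0 < d by near: d; exact: nbhs_right_gt.
by rewrite /= ler_pdivlMl // [d *: 1]mulr1 (addrC d) slope.
Unshelve. all: by end_near. Qed.

Lemma expRN_growth f F (l : R) a b : (forall x, is_derive x 1 F (f x)) ->
    (forall x, l * F x <= f x) -> a <= b ->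
  expR (- l * a) * F a <= expR (- l * b) * F b.
Proof.
move=> dF growth ab.
have dE x : is_derive x 1 (fun y => expR (- l * y) * F y)
    (expR (- l * x) * (f x - l * F x)).
  by refine (is_derive_eq _ _); ring.
by apply: (is_derive_le ab dE) => x _; rewrite mulr_ge0 ?expR_ge0 ?subr_ge0.
Qed.

Lemma expR_growth f F (l : R) a b : (forall x, is_derive x 1 F (f x)) ->
  (forall x, l * F x <= f x) -> a <= b -> expR (l * (b - a)) * F a <= F b.
Proof.
move=> dF growth ab; have := expRN_growth dF growth ab.
rewrite -(ler_pM2l (expR_gt0 (l * b))) !mulrA -!expRD.
by rewrite !mulNr subrr expR0 mul1r -mulrBr.
Qed.

End DerivativeComparison.

Section Primitive.
Context {R : realType}.
Implicit Types (f F : R -> R) (c x : R).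

Lemma continuous_primitive_ray f c : continuous f ->
  exists F, forall x, c < x -> is_derive x 1 F (f x).
Proof.
move=> cf; exists (fun x => \int[@lebesgue_measure R]_(t in `[c, x]) f t)%R.
move=> x cx; have x1 : x < x + 1 by rewrite ltrDl.
have fI : (@lebesgue_measure R).-integrable `[c, x + 1] (EFin \o f).
  apply: continuous_compact_integrable; first exact: segment_compact.
  exact: continuous_subspaceT.
have [dF FE] := continuous_FTC1_closed x1 fI cx (cf x).
by apply: DeriveDef; [exact: dF|rewrite -derive1E FE].
Qed.

Lemma continuous_primitive f : continuous f ->
  exists F, forall x, is_derive x 1 F (f x).
Proof.
move=> cf.
have /choice[G dG] (n : nat) := continuous_primitive_ray (- n%:R) cf.
pose Q n x := G n x - G n 0.
have dQ n x : - n%:R < x -> is_derive x 1 (Q n) (f x).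
  by move=> /dG dGx; refine (is_derive_eq _ _); rewrite subr0.
have Q_unique n m x : - n.+1%:R < x -> - m.+1%:R < x -> Q n.+1 x = Q m.+1 x.
  move=> nx mx; have [x0|/ltW x0] := leP 0 x.
    by apply: (is_derive_eq_sub x0 (f := f) (g := f)) => // y /andP[y0 _];
      apply: dG; apply: lt_le_trans y0; rewrite oppr_lt0.
  apply: oppr_inj; rewrite /Q !opprB.
  by apply: (is_derive_eq_sub x0 (f := f) (g := f)) => // y /andP[xy _];
    apply: dG; exact: lt_le_trans xy.
pose k x := (Num.truncn (- x)).+1.
have kP x : - (k x)%:R < x by rewrite ltrNl truncnS_gt.
exists (fun x => Q (k x) x) => x.
have kx : - (k x).+1%:R < x by apply: lt_trans (kP x); rewrite ltrN2 ltr_nat.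
have := dQ _ _ kx; apply: near_eq_is_derive => //.
near=> y; apply: Q_unique; last exact: kP.
near: y; exists 1 => //= y /=; rewrite ltr_norml => /andP[_ xy].
by have := kP x; rewrite -natr1; lra.
Unshelve. all: by end_near. Qed.

End Primitive.

Section DiscountedPrimitive.
Context {R : realType}.
Implicit Types (s x t : R) (K k U : R -> R).

Definition discounted_primitive s K U : Prop :=
  forall x : R, is_derive x 1 U (expR (- s * x) * K x).

Definition discounted_total s K U x : R := expR (- s * x) * K x + s * U x.

Definition delay_rate s : R := s * expR (- s).

Lemma delay_rate_gt0 s : 0 < s -> 0 < delay_rate s.
Proof. by move=> s0; rewrite mulr_gt0 ?expR_gt0. Qed.

Lemma delay_rateE s : delay_rate s = (rho_s s)^-1.
Proof. by rewrite /delay_rate /rho_s invf_div expRN. Qed.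

Lemma discounted_primitive_ex s K : continuous K ->
  exists U, discounted_primitive s K U.
Proof.
move=> cK; have cE : continuous (fun x => expR (- s * x) * K x).
  move=> x; apply: cvgM; last exact: cK.
  apply: (@continuous_comp _ _ _ ( *%R (- s)) expR).
    exact: mulrl_continuous.
  exact: continuous_expR.
exact: continuous_primitive cE.
Qed.

Lemma is_derive_discount s x : s != 0 ->
  is_derive x 1 (fun y => - s^-1 * expR (- s * y)) (expR (- s * x)).
Proof. by move=> s0; refine (is_derive_eq _ _); field. Qed.

(* Integration by parts. *)
Lemma is_derive_discounted_total s K k U x :
    (forall y : R, is_derive y 1 K (k y)) -> discounted_primitive s K U ->
  is_derive x 1 (discounted_total s K U) (expR (- s * x) * k x).
Proof.
by move=> dK dU; have dUx := dU x; refine (is_derive_eq _ _); ring.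
Qed.

End DiscountedPrimitive.

Section SmoothDelayInequality.
Context {R : realType}.
Implicit Types a b t tau x : R.
Variables (s kappa : R) (K k U : R -> R).
Hypotheses (s_gt0 : 0 < s) (s_le1 : s <= 1) (kappa_gt0 : 0 < kappa).
Hypothesis dK : forall x : R, is_derive x 1 K (k x).
Hypothesis dU : discounted_primitive s K U.
Hypothesis K_gt0 : forall t, 0 < K t.
Hypothesis delay : forall t, (delay_rate s + kappa) * K (t + 1) <= k t.
Hypothesis k_ge1 : forall t, 0 <= t -> 1 <= k t.

Lemma smooth_delay_le t : delay_rate s * K (t + 1) <= k t.
Proof.
apply: le_trans (delay t); rewrite mulrDl lerDl.
by rewrite mulr_ge0 // ltW.
Qed.

(* The best growth rate [l] satisfies [l >= s e^(l - s)], hence [l >= s] since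
   [s <= 1]. *)
Lemma smooth_growth t : s * K t <= k t.
Proof.
pose E := [set x | exists t, x = k t / K t].
have E0 : E !=set0 by exists (k 0 / K 0), 0.
have Elb : lbound E 0.
  move=> _ [u ->]; apply: divr_ge0; last exact: ltW.
  by apply: le_trans (smooth_delay_le u); rewrite mulr_ge0 ?ltW ?delay_rate_gt0.
set l := inf E.
have lK u : l * K u <= k u.
  by rewrite -ler_pdivlMr //; apply: ge_inf; [exists 0|exists u].
have growth1 u : expR l * K u <= K (u + 1).
  have u1 : u <= u + 1 by rewrite lerDl.
  by have := expR_growth dK lK u1; rewrite addrAC subrr add0r mulr1.
have rate_le : s * expR (l - s) + kappa * expR l <= l.
  apply: lb_le_inf => // _ [u ->]; rewrite ler_pdivlMr //.
  have rate_gt0 : 0 < delay_rate s + kappa by rewrite addr_gt0 ?delay_rate_gt0.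
  apply: le_trans (delay u); have := growth1 u; rewrite -(ler_pM2l rate_gt0).
  by rewrite expRD /delay_rate; lra.
have rate_ge : s <= l.
  rewrite leNgt; apply/negP => ls.
  have kl : 0 < kappa * expR l by rewrite mulr_gt0 ?expR_gt0.
  have := expR_ge1Dx (l - s); rewrite -(ler_pM2l s_gt0).
  have : 0 <= (1 - s) * (s - l) by rewrite mulr_ge0 // subr_ge0 // ltW.
  by lra.
by apply: le_trans (lK t); rewrite ler_pM2r.
Qed.

Lemma smooth_growth_expR a b : a <= b -> expR (s * (b - a)) * K a <= K b.
Proof. exact: expR_growth dK smooth_growth. Qed.

Lemma smooth_nondecreasing a b : a <= b -> K a <= K b.
Proof.
move=> ab; apply: le_trans (smooth_growth_expR ab).
rewrite ler_peMl //; first exact: ltW.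
by rewrite leNgt expR_lt1 -leNgt mulr_ge0 ?subr_ge0 // ltW.
Qed.

Lemma discounted_nondecreasing a b : a <= b ->
  expR (- s * a) * K a <= expR (- s * b) * K b.
Proof. exact: expRN_growth dK smooth_growth. Qed.

(* The function [I] of the header. *)
Definition delay_potential t := expR (- s * t) * K t - s * (U (t + 1) - U t).

Lemma is_derive_delay_potential t : is_derive t 1 delay_potential
  (expR (- s * t) * (k t - delay_rate s * K (t + 1))).
Proof.
have dU0 := dU t; have dU1 := is_derive_comp_shift (dU (t + 1)).
by refine (is_derive_eq _ _); rewrite [- s * (t + 1)]mulrDr mulr1 expRD;
  rewrite /delay_rate; ring.
Qed.

Lemma delay_potential_nondecreasing a b : a <= b ->
  delay_potential a <= delay_potential b.
Proof.
move=> ab; apply: (is_derive_le ab is_derive_delay_potential) => x _.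
by rewrite mulr_ge0 ?expR_ge0 // subr_ge0 smooth_delay_le.
Qed.

Lemma delay_potential_ge t :
  expR (- s * t) * K t - expR (- s * (t + 1)) * K (t + 1) <= delay_potential t.
Proof.
have t1 : t < t + 1 by rewrite ltrDl.
have [c /andP[_ /ltW ct1]] := is_derive_MVT t1 (fun x _ => dU x).
rewrite /delay_potential addrAC subrr add0r mulr1 => ->; rewrite lerB //.
apply: le_trans (discounted_nondecreasing ct1).
by rewrite ler_piMl // mulr_ge0 ?expR_ge0 // ltW.
Qed.

(* The lower bounds of [delay_potential_ge] at [t - 1, t - 2, ...] telescope. *)
Lemma delay_potential_ge0 t : 0 <= delay_potential t.
Proof.
pose u (n : nat) := expR (- s * (t - n%:R)) * K (t - n%:R).
have u_ge0 n : 0 <= u n by rewrite mulr_ge0 ?expR_ge0 // ltW.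
have telescope n : u n - u 0%N <= n%:R * delay_potential t.
  elim: n => [|n IHn]; first by rewrite subrr mul0r.
  have := delay_potential_ge (t - n.+1%:R).
  have -> : t - n.+1%:R + 1 = t - n%:R by rewrite -natr1; ring.
  have : delay_potential (t - n.+1%:R) <= delay_potential t.
    by apply: delay_potential_nondecreasing; rewrite gerBl.
  by rewrite -/(u n.+1) -/(u n) -[n.+1%:R]natr1 mulrDl mul1r; lra.
rewrite leNgt; apply/negP => potential_lt0.
set n := (Num.truncn (u 0%N / - delay_potential t)).+1.
have : u 0%N / - delay_potential t < n%:R := truncnS_gt _.
rewrite ltr_pdivrMr ?oppr_gt0 //.
by have := telescope n; have := u_ge0 n; lra.
Qed.

Lemma delay_potential_gap : kappa * K 0 <= delay_potential 0.
Proof.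
have N1_lt0 : - 1 < 0 :> R by rewrite oppr_lt0.
have [c /andP[c1 c0]] :=
  is_derive_MVT N1_lt0 (fun x _ => is_derive_delay_potential x).
rewrite sub0r opprK mulr1 => gapE.
have gap_ge : kappa * K (c + 1) <= k c - delay_rate s * K (c + 1).
  by rewrite lerBrDr -mulrDl addrC.
have K0c : kappa * K 0 <= kappa * K (c + 1).
  by rewrite ler_pM2l // smooth_nondecreasing //; lra.
have : k c - delay_rate s * K (c + 1) <=
    expR (- s * c) * (k c - delay_rate s * K (c + 1)).
  rewrite ler_peMl ?subr_ge0 ?smooth_delay_le //.
  by rewrite leNgt expR_lt1 -leNgt mulNr -mulrN mulr_ge0 ?oppr_ge0 // ltW.
by have := delay_potential_ge0 (- 1); lra.
Qed.

Local Notation J := (discounted_total s K U).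

Let dJ x := is_derive_discounted_total x dK dU.

Lemma discounted_increment_head tau : 0 <= tau ->
  (1 - expR (- s * tau)) / s <= J tau - J 0.
Proof.
move=> tau0.
have dE x := is_derive_discount x (lt0r_neq0 s_gt0).
have slope x : 0 < x < tau -> expR (- s * x) <= expR (- s * x) * k x.
  by move=> /andP[x0 _]; rewrite ler_peMr ?expR_ge0 // k_ge1 // ltW.
have := is_derive_le_sub tau0 (fun x _ => dE x) (fun x _ => dJ x) slope.
by rewrite mulr0 expR0; lra.
Qed.

Lemma discounted_increment_tail tau : 0 <= tau <= 1 ->
  (1 - tau) * (delay_rate s * K 1) <= J 1 - J tau.
Proof.
move=> /andP[tau0 tau1].
have dL x :
    is_derive x 1 (fun y => delay_rate s * K 1 * y) (delay_rate s * K 1).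
  by refine (is_derive_eq _ _); ring.
have slope x : tau < x < 1 -> delay_rate s * K 1 <= expR (- s * x) * k x.
  move=> /andP[tau_x _]; have x1 : 1 <= x + 1 by lra.
  have := smooth_growth_expR x1.
  rewrite addrK -(ler_pM2l (delay_rate_gt0 s_gt0)) => growth.
  have := le_trans growth (smooth_delay_le x).
  rewrite -(ler_pM2l (expR_gt0 (- s * x))); apply: le_trans.
  by rewrite mulrCA [expR (- s * x) * _]mulrA -expRD mulNr addNr expR0 mul1r.
have := is_derive_le_sub tau1 (fun x _ => dL x) (fun x _ => dJ x) slope.
by rewrite !mulr1; lra.
Qed.

Lemma smooth_delay_lower_bound tau : 0 <= tau <= 1 ->
  (1 - expR (- s * tau)) / s + (1 - tau) * (delay_rate s * K 1) + kappa * K 0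
  <= expR (- s) * K 1.
Proof.
move=> tau01; have /andP[tau0 _] := tau01.
have := delay_potential_gap; have := discounted_increment_tail tau01.
have := discounted_increment_head tau0.
rewrite /delay_potential /discounted_total mulr0 mulr1 expR0 mul1r add0r.
by lra.
Qed.

End SmoothDelayInequality.

Section DelayInequality.
Context {R : realType}.
Implicit Types (s rho tau t d h x : R) (H G : R -> R).

Definition delay_supersolution rho H : Prop :=
  [/\ continuous H, forall t, 0 < H t,
      forall t d, 0 < d -> d / rho * H (t + 1) <= H (t + d) - H t &
      forall t d, 0 <= t -> 0 < d -> d <= H (t + d) - H t].

Lemma delay_supersolution_nondecreasing rho H : 0 < rho ->
  delay_supersolution rho H -> {homo H : t u / t <= u}.
Proof.
move=> rho0 [_ H0 delay _] t u; rewrite le_eqVlt => /predU1P[->//|tu].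
have ut : 0 < u - t by rewrite subr_gt0.
have := delay t (u - t) ut.
rewrite [t + (u - t)]addrC subrK -[H t <= H u]subr_ge0.
by apply: le_trans; rewrite mulr_ge0 ?divr_ge0 // ltW.
Qed.

(* [G] being a primitive of [H], this is the mean of [H] over [t, t + h]; it
   satisfies the same linear inequalities as [H] and is differentiable. *)
Definition moving_mean h G t : R := (G (t + h) - G t) / h.

Section MovingMean.
Variables (rho h : R) (H G : R -> R).
Hypotheses (rho_gt0 : 0 < rho) (h_gt0 : 0 < h).
Hypothesis supH : delay_supersolution rho H.
Hypothesis dG : forall t, is_derive t 1 G (H t).

Lemma is_derive_moving_mean t :
  is_derive t 1 (moving_mean h G) ((H (t + h) - H t) / h).
Proof.
have dGt := dG t; have dGh := is_derive_comp_shift (dG (t + h)).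
by refine (is_derive_eq _ _); ring.
Qed.

Lemma moving_mean_bounds t : H t <= moving_mean h G t <= H (t + h).
Proof.
have th : t < t + h by rewrite ltrDl.
have [c /andP[tc ch]] := is_derive_MVT th (fun x _ => dG x).
rewrite /moving_mean addrAC subrr add0r => ->; rewrite mulfK ?gt_eqF //.
by rewrite !(delay_supersolution_nondecreasing rho_gt0 supH) ?ltW.
Qed.

Lemma moving_mean_delay t d : 0 < d ->
  d / rho * moving_mean h G (t + 1) <=
  moving_mean h G (t + d) - moving_mean h G t.
Proof.
case: supH => _ _ delay _ d0.
have dL x : is_derive x 1 (fun y => d / rho * G (y + 1)) (d / rho * H (x + 1)).
  have dG1 := is_derive_comp_shift (dG (x + 1)).
  by refine (is_derive_eq _ _); ring.
have dD x : is_derive x 1 (fun y => G (y + d) - G y) (H (x + d) - H x).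
  have dGx := dG x; have dGd := is_derive_comp_shift (dG (x + d)).
  exact: is_derive_subfun.
have th : t <= t + h by rewrite lerDl ltW.
have := is_derive_le_sub th (fun x _ => dL x) (fun x _ => dD x)
  (fun x _ => delay x d d0).
rewrite -mulrBr -(ler_pM2r (_ : 0 < h^-1)) ?invr_gt0 // -mulrA => averaged.
rewrite /moving_mean -mulrBl (addrAC t 1 h) (addrAC t d h).
by move: averaged; lra.
Qed.

Lemma moving_mean_derive_delay t :
  rho^-1 * moving_mean h G (t + 1) <= (H (t + h) - H t) / h.
Proof.
apply: (is_derive_slope_ge (is_derive_moving_mean t)) => d d0.
by rewrite mulrA moving_mean_delay.
Qed.

Lemma moving_mean_derive_ge1 t : 0 <= t -> 1 <= (H (t + h) - H t) / h.
Proof. by case: supH => _ _ _ slope t0; rewrite ler_pdivlMr // mul1r slope. Qed.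

End MovingMean.

Lemma delay_lower_bound s rho tau H : 0 < s <= 1 -> 0 < rho < rho_s s ->
    0 <= tau <= 1 -> delay_supersolution rho H ->
  (1 - expR (- s * tau)) / s + (1 - tau) * (delay_rate s * H 1)
    < expR (- s) * H 1.
Proof.
move=> /andP[s0 s1] /andP[rho0 rhos] tau01 supH.
have [cH H0 _ _] := supH; have [G dG] := continuous_primitive cH.
pose kappa := rho^-1 - delay_rate s.
have kappa0 : 0 < kappa.
  by rewrite subr_gt0 delay_rateE ltf_pV2 // posrE divr_gt0 ?expR_gt0.
pose gap t := expR (- s) * (1 - (1 - tau) * s) * H t.
suff : (1 - expR (- s * tau)) / s + kappa * H 0 <= gap 1.
  by have := mulr_gt0 kappa0 (H0 0); rewrite /gap /delay_rate; lra.
have gap_coef : 0 <= expR (- s) * (1 - (1 - tau) * s).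
  rewrite mulr_ge0 ?expR_ge0 // subr_ge0 mulr_ile1 //; lra.
have gap_cvg : gap (h + 1) @[h --> 0^'+] --> gap 1.
  apply: cvg_at_right_filter; rewrite -[in gap 1](add0r 1).
  have shift_cvg : h + 1 @[h --> (0 : R)] --> (0 + 1 : R).
    by apply: cvgD; [exact: cvg_id|exact: cvg_cst].
  by apply: cvgMr; exact: (cvg_comp _ _ shift_cvg (cH _)).
apply: (cvgr_to_ge gap_cvg); near=> h.
have h0 : 0 < h by near: h; exact: nbhs_right_gt.
pose K := moving_mean h G.
have cK : continuous K := is_derive_continuous (is_derive_moving_mean h dG).
have [U dU] := discounted_primitive_ex s cK.
have bounds t := moving_mean_bounds rho0 h0 supH dG t.
have K0 t : 0 < K t by apply: lt_le_trans (H0 t) _; case/andP: (bounds t).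
have delay t : (delay_rate s + kappa) * K (t + 1) <= (H (t + h) - H t) / h.
  by rewrite addrC subrK moving_mean_derive_delay.
have := smooth_delay_lower_bound s0 s1 kappa0 (is_derive_moving_mean h dG) dU
  K0 delay (moving_mean_derive_ge1 h0 supH) tau01.
have /andP[H0K _] := bounds 0; have /andP[_ K1H] := bounds 1.
have := ler_wpM2l gap_coef K1H; have := ler_wpM2l (ltW kappa0) H0K.
by rewrite /gap (addrC h) -/K /delay_rate; lra.
Unshelve. all: by end_near. Qed.

End DelayInequality.

Section RankProfile.
Context {R : realType}.
Implicit Types (y z t d T : R) (c A F : R -> R).

(* [F T] is the expected rank of the bid reaching [T], normalized at [1], [A T]
   the expected total of the earlier bids and [c T] the expected cost on [T]. *)
Definition rank_profile c A F : Prop :=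
  [/\ F 1 = 0, forall y, 0 < y -> 0 <= A y,
      forall y z, 0 < y -> 0 < z -> A y + y * (F z - F y) <= A z &
      forall y T, 0 < y -> 0 < T -> A y + y * (1 + F T - F y) <= c T].

Definition support_lines A F t : set R :=
  [set x | exists2 y, 0 < y & x = A y + y * (t - F y)].

Definition rank_envelope A F t : R := sup (support_lines A F t).

Variables (c A F : R -> R) (rho : R).
Hypotheses (profile : rank_profile c A F) (rho_gt0 : 0 < rho).
Hypothesis robust_c : forall T, 0 < T -> c T <= rho * T.

Local Notation H := (rank_envelope A F).

Lemma rank_step T : 0 < T -> F T + 2^-1 <= F (2 * rho * T).
Proof.
case: profile => _ A0 _ cost_ge T0.
have y0 : 0 < 2 * rho * T by rewrite !mulr_gt0.
have yE : 2 * rho * T * 2^-1 = rho * T by field.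
rewrite -(ler_pM2l y0) mulrDr yE.
by have := le_trans (cost_ge _ _ y0 T0) (robust_c T0); have := A0 _ y0; lra.
Qed.

Lemma rank_iter n T : 0 < T -> F T + n%:R / 2 <= F ((2 * rho) ^+ n * T).
Proof.
move=> T0; elim: n => [|n IHn]; first by rewrite expr0 mul1r mul0r addr0.
have : 0 < (2 * rho) ^+ n * T by rewrite mulr_gt0 // exprn_gt0 // mulr_gt0.
by move=> /rank_step; rewrite exprS -[in X in _ -> X]mulrA -[n.+1%:R]natr1; lra.
Qed.

Lemma rank_unbounded_above t : exists2 T, 0 < T & t <= F T.
Proof.
case: profile => F1 _ _ _; set n := (Num.truncn (2 * t)).+1.
exists ((2 * rho) ^+ n * 1); first by rewrite mulr1 exprn_gt0 // mulr_gt0.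
apply: le_trans (rank_iter n ltr01); have := truncnS_gt (2 * t).
by rewrite F1 -/n; lra.
Qed.

Lemma rank_unbounded_below t : exists2 T, 0 < T & F T <= t.
Proof.
case: profile => F1 _ _ _; set n := (Num.truncn (- 2 * t)).+1.
have q0 : 0 < (2 * rho) ^+ n by rewrite exprn_gt0 // mulr_gt0.
exists ((2 * rho) ^- n); first by rewrite invr_gt0.
have /(rank_iter n) : 0 < (2 * rho) ^- n by rewrite invr_gt0.
rewrite divff ?gt_eqF // F1; have := truncnS_gt (- 2 * t).
by rewrite -/n; lra.
Qed.

Lemma support_lines_ubound T t : 0 < T -> t <= F T ->
  ubound (support_lines A F (t + 1)) (c T).
Proof.
case: profile => _ _ _ cost_ge T0 tT _ [y y0 ->].
by apply: le_trans (cost_ge _ _ y0 T0); rewrite lerD2l ler_pM2l //; lra.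
Qed.

Lemma support_lines_neq0 t : support_lines A F t !=set0.
Proof. by exists (A 1 + 1 * (t - F 1)), 1. Qed.

Lemma support_lines_has_sup t : has_sup (support_lines A F t).
Proof.
split; first exact: support_lines_neq0.
have [T T0 tT] := rank_unbounded_above (t - 1); exists (c T).
by have := support_lines_ubound T0 tT; rewrite subrK.
Qed.

Lemma rank_envelope_ge t y : 0 < y -> A y + y * (t - F y) <= H t.
Proof.
by move=> y0; apply: ub_le_sup; [case: (support_lines_has_sup t)|exists y].
Qed.

Lemma rank_envelope_le_cost T t : 0 < T -> t <= F T -> H (t + 1) <= c T.
Proof.
move=> T0 tT; apply: ge_sup; first exact: support_lines_neq0.
exact: support_lines_ubound.
Qed.

Lemma rank_envelope_gt0 t : 0 < H t.
Proof.
case: profile => _ A0 _ _; have [y y0 Fy] := rank_unbounded_below (t - 1).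
apply: lt_le_trans (rank_envelope_ge t y0).
by rewrite ltr_wpDl ?A0 // mulr_gt0 //; lra.
Qed.

Lemma rank_envelope_slope_ge t d y : 0 < d -> 0 < y -> F y <= t ->
  d * y <= H (t + d) - H t.
Proof.
case: profile => _ _ convexA _ d0 y0 Fy.
rewrite lerBrDr addrC -lerBrDr.
apply: ge_sup => [|_ [z z0 ->]]; first exact: support_lines_neq0.
rewrite lerBrDr; have [zy|yz] := ltP z y.
  apply: le_trans (rank_envelope_ge (t + d) y0).
  have : 0 <= (y - z) * (t - F y) by rewrite mulr_ge0 ?subr_ge0 // ltW.
  by have := convexA _ _ z0 y0; lra.
apply: le_trans (rank_envelope_ge (t + d) z0).
have : d * y <= d * z by rewrite ler_pM2l.
by lra.
Qed.

Lemma rank_envelope_slope_le t d y : 0 < d -> 0 < y -> t + d <= F y ->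
  H (t + d) - H t <= d * y.
Proof.
case: profile => _ _ convexA _ d0 y0 Fy; rewrite lerBlDr.
apply: ge_sup => [|_ [z z0 ->]]; first exact: support_lines_neq0.
have [zy|yz] := leP z y.
  have : d * z <= d * y by rewrite ler_pM2l.
  by have := rank_envelope_ge t z0; lra.
have : 0 <= (z - y) * (F y - (t + d)) by rewrite mulr_ge0 ?subr_ge0 // ltW.
by have := convexA _ _ z0 y0; have := rank_envelope_ge t y0; lra.
Qed.

Lemma rank_envelope_nondecreasing : {homo H : t u / t <= u}.
Proof.
move=> t u; rewrite le_eqVlt => /predU1P[->//|tu].
have [y y0 Fy] := rank_unbounded_below t.
have ut : 0 < u - t by rewrite subr_gt0.
have := rank_envelope_slope_ge ut y0 Fy; rewrite [t + (u - t)]addrC subrK.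
by have := mulr_gt0 ut y0; lra.
Qed.

Lemma rank_envelope_lipschitz y t u : 0 < y -> t <= F y -> u <= F y ->
  `|H t - H u| <= y * `|t - u|.
Proof.
wlog tu : t u / t <= u.
  move=> wlog_le y0 tF uF; have [|/ltW ut] := leP t u.
    by move=> tu; exact: wlog_le.
  by rewrite distrC (distrC t) wlog_le.
move=> y0 _ uF; rewrite distrC (distrC t) !ger0_norm ?subr_ge0 //; last first.
  exact: rank_envelope_nondecreasing.
move: tu; rewrite le_eqVlt => /predU1P[->|tu]; first by rewrite !subrr mulr0.
have ut : 0 < u - t by rewrite subr_gt0.
have := @rank_envelope_slope_le t (u - t) y ut y0.
by rewrite [t + (u - t)]addrC subrK mulrC; apply.
Qed.

Lemma rank_envelope_continuous : continuous H.
Proof.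
move=> t; have [y y0 tF] := rank_unbounded_above (t + 1).
apply/cvgrPdist_lt => e e0; near=> u.
have tu1 : `|t - u| < 1 by near: u; exists 1 => //=.
have tue : `|t - u| < e / y.
  by near: u; exists (e / y) => //=; rewrite divr_gt0.
apply: le_lt_trans (rank_envelope_lipschitz y0 _ _) _; first lra.
  by move: tu1; rewrite ltr_norml => /andP[]; lra.
by rewrite mulrC -ltr_pdivlMr.
Unshelve. all: by end_near. Qed.

(* The slope of [H] at [t] separates the bids of rank at most [t] from the bids
   [T] of rank more than [t], for which [H (t + 1) <= c T <= rho * T]. *)
Lemma rank_envelope_delay t d : 0 < d -> d / rho * H (t + 1) <= H (t + d) - H t.
Proof.
move=> d0; pose slope := (H (t + d) - H t) / d.
have le_slope y : 0 < y -> F y <= t -> y <= slope.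
  by move=> y0 Fy; rewrite ler_pdivlMr // mulrC rank_envelope_slope_ge.
have slope0 : 0 < slope.
  have [y y0 Fy] := rank_unbounded_below t.
  exact: lt_le_trans y0 (le_slope y y0 Fy).
have -> : H (t + d) - H t = d / rho * (rho * slope).
  by rewrite /slope; field; rewrite !gt_eqF.
rewrite ler_pM2l ?divr_gt0 // -ler_pdivrMl //.
apply/ler_addgt0Pr => e e0; rewrite ler_pdivrMl //.
have T0 : 0 < slope + e by rewrite addr_gt0.
apply: le_trans (robust_c T0); apply: rank_envelope_le_cost => //.
rewrite leNgt; apply/negP => /ltW/(le_slope _ T0); lra.
Qed.

Lemma rank_envelope_supersolution : delay_supersolution rho H.
Proof.
case: profile => F1 _ _ _; split.
- exact: rank_envelope_continuous.
- exact: rank_envelope_gt0.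
- exact: rank_envelope_delay.
- move=> t d t0 d0; rewrite -[leLHS]mulr1.
  by apply: rank_envelope_slope_ge => //; rewrite F1.
Qed.

Lemma rank_envelope1_le_cost : H 1 <= c 1.
Proof.
case: profile => F1 _ _ _; rewrite -[X in H X](add0r 1).
by apply: rank_envelope_le_cost; rewrite ?F1.
Qed.

End RankProfile.

Section DeterministicStrategy.
Context {R : realType}.
Implicit Types (b : int -> R) (n m : int) (T y z : R).

Lemma lez_addnatP n m : n <= m -> exists k : nat, m = n + k%:Z.
Proof. by move=> nm; exists `|m - n|%N; lia. Qed.

Lemma strategy_le b n m : strategy b -> n <= m -> b n <= b m.
Proof.
move=> [_ bS] /lez_addnatP[k ->]; elim: k => [|k IHk]; first by rewrite addr0.
by apply: le_trans IHk _; rewrite -addn1 PoszD addrA ltW.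
Qed.

Lemma is_nstarP b T n : strategy b ->
  is_nstar b T n <-> b (n - 1) < T <= b n.
Proof.
move=> sb; split=> [[Tn nmin]|/andP[nT Tn]].
  rewrite Tn andbT ltNge; apply/negP => /nmin; lia.
split=> // m Tm; rewrite leNgt; apply/negP => mn.
have : b m <= b (n - 1) by apply: strategy_le => //; lia.
lra.
Qed.

Lemma is_nstar_uniq b T n m : is_nstar b T n -> is_nstar b T m -> n = m.
Proof. by move=> [Tn nP] [Tm mP]; apply/eqP; rewrite eq_le nP // mP. Qed.

Lemma nstarE b T n : is_nstar b T n -> nstar b T = n.
Proof.
by move=> bn; rewrite /nstar; apply: xget_unique => // m /is_nstar_uniq; apply.
Qed.

Lemma nstarP b T : (exists n, is_nstar b T n) -> is_nstar b T (nstar b T).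
Proof. exact: xgetPex. Qed.

Lemma is_nstar_ex b T n m : strategy b -> b m < T <= b n ->
  exists k, is_nstar b T k.
Proof.
move=> sb /andP[mT Tn].
have mn : m <= n.
  by rewrite leNgt; apply/negP => nm; have := strategy_le sb (ltW nm); lra.
have [k nE] := lez_addnatP mn.
have reached : exists j : nat, T <= b (m + j%:Z) by exists k; rewrite -nE.
case: (ex_minnP reached) => j Tj jmin; exists (m + j%:Z); apply/is_nstarP => //.
rewrite Tj andbT; case: j Tj jmin => [|j] Tj jmin.
  by rewrite addr0 in Tj; lra.
rewrite ltNge; apply/negP.
have -> : m + j.+1%:Z - 1 = m + j%:Z by lia.
by move=> /jmin; rewrite ltnn.
Qed.

Definition bid_sum b n : \bar R :=
  (\esum_(m in [set m : int | (m <= n)%R]) (b m)%:E)%E.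

Lemma bid_sum_ge0 b n : strategy b -> (0 <= bid_sum b n)%E.
Proof. by move=> [b0 _]; apply: esum_ge0 => m _; rewrite lee_fin ltW. Qed.

Lemma costE b T n : is_nstar b T n -> cost b T = bid_sum b n.
Proof.
move=> bn; rewrite /cost; case: ifPn => [_|/asboolP]; last by case; exists n.
by rewrite (nstarE bn).
Qed.

Lemma cost_fin_num_ex b T : cost b T \is a fin_num -> exists n, is_nstar b T n.
Proof. by rewrite /cost; case: ifPn => // /asboolP. Qed.

Lemma cost_ge0 b T : strategy b -> (0 <= cost b T)%E.
Proof.
by move=> sb; rewrite /cost; case: ifPn => // _; exact: (bid_sum_ge0 _ sb).
Qed.

Lemma bid_sum_series b n : strategy b ->
  bid_sum b n = (\sum_(j <oo) (b (n - j%:Z)%R)%:E)%E.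
Proof.
move=> [b0 _]; rewrite nneseries_esumT; last by move=> j; rewrite lee_fin ltW.
rewrite /bid_sum.
rewrite (@reindex_esum _ _ _ [set: nat] _ (fun j : nat => n - j%:Z)) //.
split=> [j _ /=|j k _ _ /=|m /= mn]; [lia|lia|].
by exists `|n - m|%N => //; lia.
Qed.

Lemma bid_sum_recr b n : strategy b ->
  bid_sum b n = (bid_sum b (n - 1) + (b n)%:E)%E.
Proof.
move=> [b0 _]; rewrite /bid_sum (esumID [set m : int | m <= n - 1]); last first.
  by move=> m _; rewrite lee_fin ltW.
congr (_ + _)%E.
  by congr esum; apply/seteqP; split => [m [_ //]|m /= mn]; split=> //=; lia.
rewrite [X in esum X](_ : _ = [set n]) ?esum_set1 ?lee_fin 1?ltW //.
apply/seteqP; split => [m /= [mn /negP]|m /= ->]; first lia.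
by split=> //; apply/negP; lia.
Qed.

Lemma bid_sum_le b n m : strategy b -> n <= m -> (bid_sum b n <= bid_sum b m)%E.
Proof.
move=> sb /lez_addnatP[k ->]; elim: k => [|k IHk]; first by rewrite addr0.
apply: le_trans IHk _; rewrite [leRHS]bid_sum_recr //.
rewrite (_ : n + k.+1%:Z - 1 = n + k%:Z); last by lia.
by rewrite leeDl // lee_fin ltW //; case: sb.
Qed.

Lemma bid_sum_fin_num b n m : strategy b ->
  bid_sum b n \is a fin_num -> bid_sum b m \is a fin_num.
Proof.
move=> sb nfin.
have fin_numS k :
    (bid_sum b k \is a fin_num) = (bid_sum b (k - 1) \is a fin_num).
  by rewrite bid_sum_recr // fin_numD andbT.
have fin_numD k (i : nat) : (bid_sum b (k + i%:Z) \is a fin_num) =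
    (bid_sum b k \is a fin_num).
  elim: i => [|i <-]; first by rewrite addr0.
  by rewrite fin_numS; congr (bid_sum b _ \is a fin_num); lia.
have [/lez_addnatP[k ->]|/ltW/lez_addnatP[k nE]] := leP n m.
  by rewrite fin_numD.
by rewrite -(fin_numD m k) -nE.
Qed.

Lemma fine_bid_sum_recr b n m : strategy b -> bid_sum b n \is a fin_num ->
  fine (bid_sum b m) = fine (bid_sum b (m - 1)) + b m.
Proof.
move=> sb nfin.
have fin k : bid_sum b k \is a fin_num := bid_sum_fin_num k sb nfin.
by rewrite {1}bid_sum_recr // fineD.
Qed.

(* Bids up to [n - 1] are below [y] and bids from [n] on are at least [y]. *)
Lemma bid_sum_convex b y n m : strategy b -> is_nstar b y n ->
    bid_sum b n \is a fin_num ->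
  fine (bid_sum b (n - 1)) + y * (m - n + 1)%:~R <= fine (bid_sum b m).
Proof.
move=> sb /is_nstarP - /(_ sb) /andP[ny yn] nfin.
have recr k := fine_bid_sum_recr k sb nfin.
have [nm|mn] := leP (n - 1) m.
  have [k ->] := lez_addnatP nm; elim: k => [|k IHk].
    by rewrite addr0 (_ : n - 1 - n + 1 = 0) ?mulr0 ?addr0 //; lia.
  rewrite [leRHS]recr.
  have -> : n - 1 + k.+1%:Z - 1 = n - 1 + k%:Z by lia.
  have -> : n - 1 + k.+1%:Z - n + 1 = (n - 1 + k%:Z - n + 1) + 1 by lia.
  have : b n <= b (n - 1 + k.+1%:Z) by apply: strategy_le => //; lia.
  by rewrite intrD mulrDr; lra.
have [k nE] := lez_addnatP (ltW mn).
have {mn nE}-> : m = n - 1 - k%:Z by lia.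
elim: k => [|k IHk].
  by rewrite subr0 (_ : n - 1 - n + 1 = 0) ?mulr0 ?addr0 //; lia.
move: IHk; rewrite [fine (bid_sum b (n - 1 - k%:Z))]recr.
have -> : n - 1 - k%:Z - 1 = n - 1 - k.+1%:Z by lia.
have -> : n - 1 - k%:Z - n + 1 = (n - 1 - k.+1%:Z - n + 1) + 1 by lia.
have : b (n - 1 - k%:Z) <= b (n - 1) by apply: strategy_le => //; lia.
by rewrite intrD mulrDr; lra.
Qed.

(* Only countably many targets, so that this can hold almost surely; it makes
   all costs finite ([finite_costs_cost]). *)
Definition finite_costs b : Prop := forall k : nat,
  cost b k.+1%:R \is a fin_num /\ cost b k.+1%:R^-1 \is a fin_num.

Definition finite_cost b T : R := fine (cost b T).
Definition earlier_bids b y : R := fine (bid_sum b (nstar b y - 1)).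
Definition bid_rank b T : R := (nstar b T)%:~R - (nstar b 1)%:~R.

Lemma finite_costs_nstar b T : strategy b -> finite_costs b -> 0 < T ->
  is_nstar b T (nstar b T).
Proof.
move=> sb finb T0; apply: nstarP.
have /cost_fin_num_ex[n [Tn _]] := (finb (Num.truncn T)).1.
have /cost_fin_num_ex[m /is_nstarP-/(_ sb) /andP[mT _]] :=
  (finb (Num.truncn T^-1)).2.
apply: (@is_nstar_ex b T n (m - 1)) => //.
rewrite (le_trans (ltW (truncnS_gt T))) // andbT; apply: lt_trans mT _.
by rewrite invf_plt ?posrE // truncnS_gt.
Qed.

Lemma finite_costs_bid_sum b n : strategy b -> finite_costs b ->
  bid_sum b n \is a fin_num.
Proof.
move=> sb finb; have nstar1 := finite_costs_nstar sb finb ltr01.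
apply: (@bid_sum_fin_num _ (nstar b 1)) => //.
by rewrite -(costE nstar1); case: (finb 0%N).
Qed.

Lemma finite_costs_cost b T : strategy b -> finite_costs b -> 0 < T ->
  cost b T \is a fin_num.
Proof.
move=> sb finb T0; rewrite (costE (finite_costs_nstar sb finb T0)).
exact: finite_costs_bid_sum.
Qed.

Lemma strategy_rank_profile b : strategy b -> finite_costs b ->
  rank_profile (finite_cost b) (earlier_bids b) (bid_rank b).
Proof.
move=> sb finb; rewrite /bid_rank; split; first exact: subrr.
- by move=> y _; rewrite fine_ge0 // bid_sum_ge0.
- move=> y z y0 z0; have nstary := finite_costs_nstar sb finb y0.
  have := bid_sum_convex (nstar b z - 1) sb nstary
    (finite_costs_bid_sum _ sb finb).
  by rewrite /earlier_bids addrAC subrK intrB; lra.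
- move=> y T y0 T0; have nstary := finite_costs_nstar sb finb y0.
  have := bid_sum_convex (nstar b T) sb nstary
    (finite_costs_bid_sum _ sb finb).
  rewrite /finite_cost (costE (finite_costs_nstar sb finb T0)) /earlier_bids.
  by rewrite intrD intrB; lra.
Qed.

End DeterministicStrategy.

Section MeasurableCost.
Context {R : realType} {d : measure_display} {Omega : measurableType d}.
Variable b : Omega -> int -> R.
Hypothesis rb : rand_strategy b.

Let sb w : strategy (b w) := rb.1 w.
Let mb n : measurable_fun setT (fun w => b w n) := rb.2 n.

Lemma measurable_is_nstar (T : R) n : measurable [set w | is_nstar (b w) T n].
Proof.
rewrite (_ : [set _ | _] = (fun w => b w (n - 1)) @^-1` `]-oo, T[ `&`
                           (fun w => b w n) @^-1` `[T, +oo[); last first.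
  apply/seteqP; split=> w /=; rewrite !in_itv /= andbT.
    by move=> /is_nstarP-/(_ (sb w)) /andP[].
  by move=> [nT Tn]; apply/is_nstarP => //; rewrite nT.
by apply: measurableI; rewrite -[X in measurable X]setTI; exact: mb.
Qed.

Lemma measurable_nstar_cases (T : R) (g : Omega -> \bar R)
    (gn : int -> Omega -> \bar R) (g0 : Omega -> \bar R) :
    (forall n, measurable_fun setT (gn n)) -> measurable_fun setT g0 ->
    (forall w n, is_nstar (b w) T n -> g w = gn n w) ->
    (forall w, ~ (exists n, is_nstar (b w) T n) -> g w = g0 w) ->
  measurable_fun setT g.
Proof.
move=> mgn mg0 g_gn g_g0.
pose E (k : nat) :=
  if unpickle k is Some n then [set w | is_nstar (b w) T n] else set0.
have mE k : measurable (E k).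
  by rewrite /E; case: unpickle => // n; exact: measurable_is_nstar.
have EU : \bigcup_k E k = [set w | exists n, is_nstar (b w) T n].
  apply/seteqP; split=> [w [k _]|w [n wn]] /=.
    by rewrite /E; case: unpickle => // n wn; exists n.
  by exists (pickle n) => //; rewrite /E pickleK.
have mU : measurable (\bigcup_k E k) by exact: bigcup_measurable.
rewrite -(setvU (\bigcup_k E k)); apply/measurable_funU => //.
  exact: measurableC.
split.
  apply: (@eq_measurable_fun _ _ _ _ _ g0); last exact: measurable_funTS.
  by move=> w; rewrite inE /= EU => wn; rewrite g_g0.
apply/measurable_fun_bigcup => // k; rewrite /E.
case: unpickle => [n|]; last exact: measurable_fun_set0.
apply: (@eq_measurable_fun _ _ _ _ _ (gn n)); last exact: measurable_funTS.
by move=> w; rewrite inE /= => wn; rewrite (g_gn _ _ wn).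
Qed.

Lemma measurable_bid_sum n : measurable_fun setT (fun w => bid_sum (b w) n).
Proof.
apply: (eq_measurable_fun (fun w =>
    (\sum_(j <oo | j \in xpredT) (b w (n - j%:Z)%R)%:E)%E)).
  by move=> w _; rewrite bid_sum_series.
apply: ge0_emeasurable_sum => [k w _ _|k _].
  by rewrite lee_fin ltW //; case: (sb w).
exact/measurable_EFinP/mb.
Qed.

Lemma measurable_cost (T : R) : measurable_fun setT (fun w => cost (b w) T).
Proof.
apply: (@measurable_nstar_cases T _ (fun n w => bid_sum (b w) n)
                                   (cst +oo%E)) => //.
- exact: measurable_bid_sum.
- by move=> w n; exact: costE.
- by move=> w wn; rewrite /cost; case: ifPn => // /asboolP.
Qed.

Lemma measurable_nstar (T : R) :
  measurable_fun setT (fun w => (nstar (b w) T)%:~R : R).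
Proof.
apply/measurable_EFinP.
apply: (@measurable_nstar_cases T _ (fun n w => (n%:~R)%:E) (cst 0%E)) => //.
- by move=> w n /nstarE /= ->.
- by move=> w wn /=; rewrite /nstar xgetPN // => n nstar_n; apply: wn; exists n.
Qed.

Lemma measurable_earlier_bids (T : R) :
  measurable_fun setT (fun w => earlier_bids (b w) T).
Proof.
apply: measurableT_comp => //.
apply: (@measurable_nstar_cases T _ (fun n w => bid_sum (b w) (n - 1))
                                   (fun w => bid_sum (b w) (- 1))).
- by move=> n; exact: measurable_bid_sum.
- exact: measurable_bid_sum.
- by move=> w n /nstarE ->.
- move=> w wn; rewrite /nstar xgetPN ?sub0r // => n nstar_n.
  by apply: wn; exists n.
Qed.

Lemma measurable_bid_rank (T : R) :
  measurable_fun setT (fun w => bid_rank (b w) T).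
Proof. by apply: measurable_funB; exact: measurable_nstar. Qed.

Lemma measurable_cost_fin_num (T : R) :
  measurable [set w | cost (b w) T \is a fin_num].
Proof.
rewrite (_ : [set _ | _] = setT `&` (fun w => cost (b w) T) @^-1` [set~ +oo%E]).
  by apply: measurable_cost => //; exact: measurableC.
apply/seteqP; split=> w /=.
  by move=> finw; split=> // wT; rewrite wT in finw.
by move=> [_ wT]; rewrite ge0_fin_numE ?cost_ge0 // ltey; apply/eqP.
Qed.

Lemma measurable_finite_costs : measurable [set w | finite_costs (b w)].
Proof.
rewrite (_ : [set _ | _] = \bigcap_k
    ([set w | cost (b w) k.+1%:R \is a fin_num] `&`
     [set w | cost (b w) k.+1%:R^-1 \is a fin_num])).
  apply: bigcapT_measurable => k.
  by apply: measurableI; exact: measurable_cost_fin_num.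
by apply/seteqP; split=> w finw k //=; exact: finw.
Qed.

End MeasurableCost.

Section ExpectedProfile.
Context {R : realType} {d : measure_display} {Omega : measurableType d}.
Variables (P : probability Omega R) (D : set Omega).
Variables c A F : R -> Omega -> R.
Hypotheses (mD : measurable D) (PD : P D = 1%E).
Hypothesis profile : forall w, D w -> rank_profile (c ^~ w) (A ^~ w) (F ^~ w).
Hypothesis integrable_c : forall T, 0 < T -> P.-integrable D (EFin \o c T).
Hypothesis measurable_A : forall y, measurable_fun D (A y).
Hypothesis measurable_F : forall y, measurable_fun D (F y).

Local Notation "''E' f" := (\int[P]_(w in D) f w) (at level 10, f at level 8).

Lemma integrable_profile_earlier y : 0 < y -> P.-integrable D (EFin \o A y).
Proof.
move=> y0; apply: le_integrable (integrable_c y0) => //.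
  exact/measurable_EFinP.
move=> w Dw /=; have [_ A0 _ cost_ge] := profile Dw; rewrite lee_fin.
have := cost_ge _ _ y0 y0; have := A0 _ y0; rewrite addrK mulr1 => Ay0 cy.
by rewrite !ger0_norm //; lra.
Qed.

Lemma integrable_profile_rank T : 0 < T -> P.-integrable D (EFin \o F T).
Proof.
move=> T0; pose g w := c T w + T^-1 * c 1 w.
have gI : P.-integrable D (EFin \o g).
  have cI := integrable_c T0; have c1I := integrable_c (@ltr01 R).
  exact: (integrableD mD cI (integrableZl mD T^-1 c1I)).
apply: le_integrable gI => //; first exact/measurable_EFinP.
move=> w Dw /=; have [F1 A0 _ cost_ge] := profile Dw; rewrite lee_fin.
have := cost_ge _ _ ltr01 T0; have := cost_ge _ _ T0 ltr01.
have := cost_ge _ _ ltr01 ltr01; have := cost_ge _ _ T0 T0.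
have := A0 _ ltr01; have := A0 _ T0; rewrite F1 => AT0 A10 cTT c11 cT1 c1T.
have rank_ge : 1 - F T w <= T^-1 * c 1 w by rewrite ler_pdivlMl //; lra.
have c1_ge0 : 0 <= T^-1 * c 1 w by rewrite mulr_ge0 ?invr_ge0 ?ltW //; lra.
by rewrite [leRHS]ger0_norm /g ?ler_norml; lra.
Qed.

Lemma expectation_affine y z : 0 < y -> 0 < z ->
  P.-integrable D (EFin \o (fun w => A y w + y * (F z w - F y w))) /\
  'E (fun w => A y w + y * (F z w - F y w)) =
  'E (A y) + y * ('E (F z) - 'E (F y)).
Proof.
move=> y0 z0.
have AI := integrable_profile_earlier y0.
have FyI := integrable_profile_rank y0; have FzI := integrable_profile_rank z0.
have BI : P.-integrable D (EFin \o (fun w => F z w - F y w)).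
  exact: (integrableB mD FzI FyI).
have ZI : P.-integrable D (EFin \o (fun w => y * (F z w - F y w))).
  exact: (integrableZl mD y BI).
split; first exact: (integrableD mD AI ZI).
by rewrite (RintegralD mD AI ZI) (RintegralZl _ mD BI) (RintegralB mD FzI FyI).
Qed.

Lemma rank_profile_expectation :
  rank_profile (fun T => 'E (c T)) (fun y => 'E (A y)) (fun y => 'E (F y)).
Proof.
split.
- under eq_Rintegral => w /set_mem Dw.
    by have [-> _ _ _] := profile Dw; over.
  by rewrite Rintegral_cst // mul0r.
- move=> y y0; apply: Rintegral_ge0 => w Dw.
  by have [_ A0 _ _] := profile Dw; exact: A0.
- move=> y z y0 z0; have [intE <-] := expectation_affine y0 z0.
  apply: le_Rintegral => //; first exact: integrable_profile_earlier.
  by move=> w Dw; have [_ _ convexA _] := profile Dw; exact: convexA.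
- move=> y T y0 T0; have [intE EE] := expectation_affine y0 T0.
  have yI : P.-integrable D (EFin \o cst y).
    exact: finite_measure_integrable_cst.
  have yE : 'E (cst y) = y.
    by rewrite Rintegral_cst // [X in fine X]PD mulr1.
  have -> : 'E (A y) + y * (1 + 'E (F T) - 'E (F y)) =
      'E (fun w => cst y w + (A y w + y * (F T w - F y w))).
    by rewrite (RintegralD mD yI intE) EE yE; ring.
  apply: le_Rintegral => //.
  - exact: (integrableD mD yI intE).
  - exact: integrable_c.
  move=> w Dw; have [_ _ _ cost_ge] := profile Dw.
  by have := cost_ge _ _ y0 T0; rewrite /cst; lra.
Qed.

End ExpectedProfile.

Section RobustProfile.
Context {R : realType} {d : measure_display} {Omega : measurableType d}.
Variables (P : probability Omega R) (b : Omega -> int -> R) (rho : R).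
Hypotheses (rb : rand_strategy b) (robust_b : robust P b rho).

Let D := [set w | finite_costs (b w)].

Lemma integrable_cost T : 0 < T -> P.-integrable setT (fun w => cost (b w) T).
Proof.
move=> T0; apply/integrableP; split; first exact: measurable_cost.
under eq_integral do rewrite (gee0_abs (cost_ge0 _ (rb.1 _))).
exact: le_lt_trans (robust_b T0) (ltry _).
Qed.

Let mD : measurable D := measurable_finite_costs rb.

Lemma infinite_costs_null : P (~` D) = 0%E.
Proof.
apply: measure_negligible; first exact: measurableC.
apply: ae_foralln => k.
have k0 : 0 < k.+1%:R^-1 :> R by rewrite invr_gt0.
have := integrable_ae measurableT (integrable_cost k0).
have := integrable_ae measurableT (integrable_cost (ltr0Sn R k)).
by apply: filterS2 => w fink finkV; split; [exact: fink|exact: finkV].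
Qed.

Lemma probability_finite_costs : P D = 1%E.
Proof.
rewrite -[D]setCK probability_setC; last exact: measurableC.
by rewrite infinite_costs_null sube0.
Qed.

Lemma integrable_finite_cost T : 0 < T ->
  P.-integrable D (EFin \o (fun w => finite_cost (b w) T)).
Proof.
move=> T0; apply: (@eq_integrable _ _ _ _ _ mD (fun w => cost (b w) T)).
  move=> w /set_mem Dw /=.
  by rewrite fineK // finite_costs_cost //; exact: rb.1.
by apply: integrableS (integrable_cost T0).
Qed.

Lemma expected_finite_cost T : 0 < T ->
  (\int[P]_(w in D) finite_cost (b w) T)%:E = rand_cost P b T.
Proof.
move=> T0; rewrite /Rintegral fineK; last first.
  by apply: integrable_fin_num => //; exact: integrable_finite_cost.
rewrite /rand_cost (negligible_integral (measurableC mD) measurableT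
  (integrable_cost T0) infinite_costs_null) setDE setCK setTI.
apply: eq_integral => w /set_mem Dw.
by rewrite fineK // finite_costs_cost //; exact: rb.1.
Qed.

Lemma robust_rank_profile : exists c A F : R -> R,
  rank_profile c A F /\ forall T, 0 < T -> (c T)%:E = rand_cost P b T.
Proof.
have profile w (Dw : D w) := strategy_rank_profile (rb.1 w) Dw.
have mA y : measurable_fun D (fun w => earlier_bids (b w) y).
  exact/measurable_funTS/measurable_earlier_bids.
have mF y : measurable_fun D (fun w => bid_rank (b w) y).
  exact/measurable_funTS/measurable_bid_rank.
have expected := rank_profile_expectation mD probability_finite_costs profile
  integrable_finite_cost mA mF.
by do 3 eexists; split; [exact: expected|exact: expected_finite_cost].
Qed.

End RobustProfile.

Section ParetoLowerBound.
Context {R : realType}.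
Implicit Types s : R.

Lemma xi_sP s : ln 2 <= s -> s <= 1 ->
  1 <= xi_s s <= expR 1 /\ xi_s s * (2 - ln (xi_s s)) = expR s.
Proof.
move=> ls s1; pose f (z : R) := expR z * (2 - z).
have cf : continuous f.
  move=> z; apply: cvgM; first exact: continuous_expR.
  by apply: cvgB; [exact: cvg_cst|exact: cvg_id].
have f0 : f 0 = 2 by rewrite /f expR0 mul1r subr0.
have f1 : f 1 = expR 1 by rewrite /f; ring.
have e2 : 2 <= expR s by rewrite -[leLHS]lnK ?posrE // ler_expR.
have es1 : expR s <= expR 1 by rewrite ler_expR.
have [|z] := @IVT R f 0 1 (expR s) ler01 (continuous_subspaceT cf).
  by rewrite f0 f1 ge_min le_max e2 es1 orbT.
rewrite in_itv /= => /andP[z0 z1] fz.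
apply: (@xgetPex _ 1 [set x : R | 1 <= x <= expR 1 /\ x * (2 - ln x) = expR s]).
exists (expR z); split; last by rewrite expRK.
by rewrite -{1}expR0 !ler_expR z0.
Qed.

(* The rank from which the optimal bids [max 1 (e^(s (t - tau_s s)))] grow. *)
Definition tau_s s : R := if s < ln 2 then 1 else 1 - ln (xi_s s) / s.

Lemma chi_s_lt s : 0 < s -> s < ln 2 ->
  tau_s s = 1 /\ s * chi_s s = expR s - 1.
Proof.
move=> s0 ls; rewrite /tau_s /chi_s ls; split=> //.
by rewrite mulrC divfK // gt_eqF.
Qed.

Lemma chi_s_ge s : ln 2 <= s -> s <= 1 ->
  [/\ 0 <= tau_s s <= 1, expR (s * (1 - tau_s s)) = s * chi_s s &
      s * chi_s s * (2 - s * (1 - tau_s s)) = expR s].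
Proof.
move=> ls s1; have [/andP[xi1 xie] xiE] := xi_sP ls s1.
have s0 : 0 < s by apply: lt_le_trans ls; rewrite ln_gt0 ?ltr1n.
have xi0 : 0 < xi_s s by lra.
have lnxi0 : 0 <= ln (xi_s s) by rewrite ln_ge0.
have lnxi1 : ln (xi_s s) <= 1.
  by rewrite -(@expRK R 1) ler_ln ?posrE ?expR_gt0.
have lnxis : ln (xi_s s) <= s.
  rewrite -[leRHS]expRK ler_ln ?posrE ?expR_gt0 // -xiE ler_peMr //; lra.
have chiE : s * chi_s s = xi_s s.
  by rewrite /chi_s ltNge ls mulrC divfK // gt_eqF.
have tauE : s * (1 - tau_s s) = ln (xi_s s).
  by rewrite /tau_s ltNge ls /=; field; rewrite gt_eqF.
split; [|by rewrite tauE lnK|by rewrite tauE chiE].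
rewrite /tau_s ltNge ls /= subr_ge0 ler_pdivrMr // mul1r lnxis.
by rewrite gerBl divr_ge0 // ltW.
Qed.

Lemma tau_s_itv s : 0 < s <= 1 -> 0 <= tau_s s <= 1.
Proof.
move=> /andP[s0 s1]; have [ls|ls] := ltP s (ln 2).
  by rewrite (chi_s_lt s0 ls).1 ler01 lexx.
by have [] := chi_s_ge ls s1.
Qed.

Lemma chi_s_le s : 0 < s <= 1 -> s * chi_s s <= expR (s * (1 - tau_s s)).
Proof.
move=> /andP[s0 s1]; have [ls|ls] := ltP s (ln 2).
  have [-> ->] := chi_s_lt s0 ls.
  rewrite subrr mulr0 expR0 lerBlDr.
  by rewrite -(lnK (_ : (1 + 1 : R) \is Num.pos)) ?posrE // ler_expR ltW.
by have [_ -> _] := chi_s_ge ls s1.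
Qed.

Lemma chi_s_slackness s : 0 < s <= 1 ->
  (1 - tau_s s) * (s * chi_s s) = (1 - tau_s s) * expR (s * (1 - tau_s s)).
Proof.
move=> /andP[s0 s1]; have [ls|ls] := ltP s (ln 2).
  by rewrite (chi_s_lt s0 ls).1 subrr !mul0r.
by have [_ -> _] := chi_s_ge ls s1.
Qed.

Lemma expR_tau_s s :
  expR (- s * tau_s s) = expR (- s) * expR (s * (1 - tau_s s)).
Proof. by rewrite -expRD; congr expR; ring. Qed.

Lemma chi_s_balance s : 0 < s <= 1 ->
  (1 - expR (- s * tau_s s)) / s + (1 - tau_s s) * expR (- s * tau_s s)
  = expR (- s) * chi_s s.
Proof.
move=> /andP[s0 s1]; rewrite expR_tau_s; set X := expR (s * _).
have chiE : s * chi_s s = expR s - X + s * (1 - tau_s s) * X.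
  rewrite /X; have [ls|ls] := ltP s (ln 2).
    have [-> ->] := chi_s_lt s0 ls.
    by rewrite subrr !mulr0 expR0 mul0r addr0.
  by have [_ -> <-] := chi_s_ge ls s1; ring.
have -> : chi_s s = (expR s - X + s * (1 - tau_s s) * X) / s.
  by rewrite -chiE mulrC mulKf // gt_eqF.
by rewrite expRN; field; rewrite !gt_eqF ?expR_gt0.
Qed.

(* With [tau = tau_s s], subtracting [chi_s_balance] from [delay_lower_bound]
   and using [chi_s_slackness] gives [(1 - s (1 - tau)) (H 1 - chi_s s) > 0]. *)
Lemma delay_supersolution_chi s rho H : 0 < s <= 1 -> 0 < rho < rho_s s ->
  delay_supersolution rho H -> chi_s s < H 1.
Proof.
move=> s01 rho_lt supH; have tau01 := tau_s_itv s01.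
have lower_bound := delay_lower_bound s01 rho_lt tau01 supH.
have balance := chi_s_balance s01; have slackness := chi_s_slackness s01.
case/andP: s01 tau01 => s0 s1 /andP[tau0 tau1].
have {lower_bound balance} :
    expR (- s) * ((1 - tau_s s) * s * (H 1 - chi_s s)) <
    expR (- s) * (H 1 - chi_s s).
  move: lower_bound balance (congr1 ( *%R (expR (- s))) slackness).
  by rewrite expR_tau_s /delay_rate; lra.
rewrite ltr_pM2l ?expR_gt0 // => gap_lt; rewrite ltNge; apply/negP => H1_le.
have : 0 <= (1 - (1 - tau_s s) * s) * (chi_s s - H 1).
  by rewrite mulr_ge0 ?subr_ge0 // mulr_ile1 //; lra.
lra.
Qed.

Lemma no_better_robustness s rho (d : measure_display)
    (Omega : measurableType d) (P : probability Omega R)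
    (b : Omega -> int -> R) :
    0 < s <= 1 -> rho < rho_s s ->
  rand_strategy b -> robust P b rho -> ~ consistent P b (chi_s s).
Proof.
move=> s01 rho_lt rb robust_b; rewrite /consistent.
have [c [A [F [profile cE]]]] := robust_rank_profile rb robust_b.
have c_le T : 0 < T -> c T <= rho * T.
  by move=> T0; rewrite -lee_fin cE // robust_b.
have rho0 : 0 < rho.
  have [_ A0 _ cost_ge] := profile.
  have := cost_ge _ _ ltr01 ltr01; have := A0 _ ltr01; have := c_le _ ltr01.
  by lra.
have rho0s : 0 < rho < rho_s s by rewrite rho0.
have supH := rank_envelope_supersolution profile rho0 c_le.
have := delay_supersolution_chi s01 rho0s supH.
have := rank_envelope1_le_cost profile.
by rewrite -cE // lee_fin; lra.
Qed.

End ParetoLowerBound.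

Section DelayEquation.
Context {R : realType}.
Variable s : R.
Hypothesis s0 : 0 < s.
Implicit Types (x y : R) (f g P Q : R -> R).

(* A solution [H] of [H' t = s e^(- s) H (t + 1)] is encoded by its pieces
   [f x = H (x - k)] for [0 <= x <= 1]. The last condition says that
   [delay_potential] vanishes, which is what keeps the pieces positive. *)
Definition delay_piece f : Prop :=
  [/\ continuous f, forall x, 0 <= x <= 1 -> 0 < f x &
      forall P, discounted_primitive s f P -> f 0 = s * (P 1 - P 0)].

Lemma discounted_primitive_lt f P x y : discounted_primitive s f P ->
  x < y -> (forall z, x < z < y -> 0 < f z) -> P x < P y.
Proof.
move=> dP xy f0; apply: is_derive_lt xy dP _ => z /f0 fz.
by rewrite mulr_gt0 ?expR_gt0.
Qed.

Section PrecedingPiece.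
Variables f g P Q : R -> R.
Hypothesis piece_f : delay_piece f.
Hypothesis dg : forall x, is_derive x 1 g (delay_rate s * f x).
Hypothesis g1 : g 1 = f 0.
Hypotheses (dP : discounted_primitive s f P) (dQ : discounted_primitive s g Q).

Lemma preceding_piece_potential x : 0 <= x <= 1 ->
  expR (- s * x) * g x = s * (Q 1 - Q x) + delay_rate s * (P x - P 0).
Proof.
move=> /andP[_ x1]; have [_ _ /(_ _ dP) f0E] := piece_f.
have dJ y := is_derive_discounted_total y dg dQ.
have dCP (y : R) : is_derive y 1 (fun z => delay_rate s * P z)
    (delay_rate s * (expR (- s * y) * f y)).
  by have dPy := dP y; refine (is_derive_eq _ _); ring.
have derivatives_eq y : x < y < 1 -> expR (- s * y) * (delay_rate s * f y) =
    delay_rate s * (expR (- s * y) * f y).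
  by move=> _; ring.
have := is_derive_eq_sub x1 (fun y _ => dJ y) (fun y _ => dCP y) derivatives_eq.
by rewrite /discounted_total mulr1 g1 f0E /delay_rate; lra.
Qed.

Lemma preceding_piece_primitive_lt x : 0 <= x < 1 -> Q x < Q 1.
Proof.
move=> /andP[x0 x1]; have [_ f_gt0 _] := piece_f.
have dV y : is_derive y 1 (fun z => expR (s * z) * (Q z - Q 1))
    (expR (s * y) * (expR (- s * y) * g y + s * (Q y - Q 1))).
  by have dQy := dQ y; refine (is_derive_eq _ _); ring.
have : expR (s * x) * (Q x - Q 1) < expR (s * 1) * (Q 1 - Q 1).
  apply: (is_derive_lt x1 dV) => y /andP[xy y1]; rewrite mulr_gt0 ?expR_gt0 //.
  have y01 : 0 <= y <= 1 by apply/andP; split; lra.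
  have P0y : P 0 < P y.
    apply: (discounted_primitive_lt dP); first lra.
    by move=> z /andP[z0 zy]; apply: f_gt0; apply/andP; split; lra.
  have : 0 < delay_rate s * (P y - P 0).
    by rewrite mulr_gt0 ?delay_rate_gt0 ?subr_gt0.
  by rewrite preceding_piece_potential //; lra.
by rewrite subrr mulr0 pmulr_rlt0 ?expR_gt0 // subr_lt0.
Qed.

End PrecedingPiece.

Lemma preceding_piece f g : delay_piece f ->
    (forall x, is_derive x 1 g (delay_rate s * f x)) -> g 1 = f 0 ->
  delay_piece g.
Proof.
move=> piece_f dg g1; have [cf f_gt0 _] := piece_f.
have cg := is_derive_continuous dg.
have [P dP] := discounted_primitive_ex s cf.
split=> [//|x x01|Q dQ]; last first.
  have := preceding_piece_potential piece_f dg g1 dP dQ (_ : 0 <= 0 <= 1).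
  by rewrite mulr0 expR0 mul1r subrr mulr0 addr0; apply; rewrite lexx ler01.
have [Q dQ] := discounted_primitive_ex s cg.
have /andP[x0] := x01; rewrite le_eqVlt => /predU1P[->|x1].
  by rewrite g1 f_gt0 // lexx ler01.
have Qx1 : Q x < Q 1.
  by apply: (preceding_piece_primitive_lt piece_f dg g1 dP dQ); rewrite x0.
have P0x : P 0 <= P x.
  move: x0; rewrite le_eqVlt => /predU1P[->//|x0]; apply/ltW.
  apply: (discounted_primitive_lt dP x0) => z /andP[z0 zx].
  by apply: f_gt0; apply/andP; split; lra.
rewrite -(pmulr_rgt0 _ (expR_gt0 (- s * x))).
rewrite (preceding_piece_potential piece_f dg g1 dP dQ) //.
rewrite ltr_pwDl ?mulr_gt0 ?mulr_ge0 ?subr_gt0 ?subr_ge0 //.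
by rewrite ltW ?delay_rate_gt0.
Qed.

Lemma preceding_piece_ex f : delay_piece f ->
  exists g, [/\ delay_piece g, forall x, is_derive x 1 g (delay_rate s * f x) &
    g 1 = f 0].
Proof.
move=> piece_f; have [cf _ _] := piece_f.
have [F dF] := continuous_primitive cf.
pose g x := f 0 - delay_rate s * (F 1 - F x).
have dg x : is_derive x 1 g (delay_rate s * f x).
  have dFx := dF x; refine (is_derive_eq _ _); ring.
have g1 : g 1 = f 0 by rewrite /g subrr mulr0 subr0.
exists g; split=> //; exact: preceding_piece piece_f dg g1.
Qed.

Definition delay_pieces (f : nat -> R -> R) : Prop := forall k,
  [/\ delay_piece (f k),
      forall x, is_derive x 1 (f k.+1) (delay_rate s * f k x) &
      f k.+1 1 = f k 0].

Lemma delay_pieces_ex f0 : delay_piece f0 ->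
  exists2 f, f 0%N = f0 & delay_pieces f.
Proof.
move=> piece0; pose T := {f | delay_piece f}.
pose precedes (f g : T) :=
  (forall x, is_derive x 1 (sval g) (delay_rate s * sval f x)) /\
  sval g 1 = sval f 0.
have step (f : T) : {g : T | precedes f g}.
  apply: cid; case: f => f piece_f.
  have [g [piece_g dg g1]] := preceding_piece_ex piece_f.
  by exists (exist _ g piece_g).
have [f [fE fS]] := dependent_choice step (exist _ f0 piece0).
exists (fun k => sval (f k)); first by rewrite fE.
by move=> k; have [df f1] := fS k; split=> //; exact: svalP.
Qed.

End DelayEquation.

Section InitialPiece.
Context {R : realType}.
Implicit Types (s tau x y : R) (f h P B : R -> R).

(* By parts, the condition on [f 0] asks that the integral of [e^(- s x) f' x]
   over [0, 1] be [e^(- s) f 1]. *)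
Lemma delay_piece_of_derivative s f h B : 0 < s ->
    (forall x, is_derive x 1 f (h x)) -> (forall x, 0 < x < 1 -> 0 < h x) ->
    discounted_primitive s h B -> B 1 - B 0 = expR (- s) * f 1 ->
  delay_piece s f.
Proof.
move=> s0 df h0 dB balance.
have f_mono x : 0 < x <= 1 -> f 0 < f x.
  move=> /andP[x0 x1]; apply: (is_derive_lt x0 df) => y /andP[y0 yx].
  by apply: h0; apply/andP; split; lra.
have f0E P : discounted_primitive s f P -> f 0 = s * (P 1 - P 0).
  move=> dP; have dJ x := is_derive_discounted_total x df dP.
  have := is_derive_eq_sub ler01 (fun x _ => dJ x) (fun x _ => dB x)
    (fun _ _ => erefl).
  by rewrite /discounted_total mulr1 mulr0 expR0 mul1r balance; lra.
suff f0 : 0 < f 0.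
  split=> [|x /andP[]|//]; first exact: is_derive_continuous df.
  rewrite le_eqVlt => /predU1P[<-//|x0 x1].
  by apply: lt_trans f0 _; apply: f_mono; rewrite x0.
have [P dP] := discounted_primitive_ex s (is_derive_continuous df).
have dD x : is_derive x 1 (fun y => P y + f 0 / s * expR (- s * y))
    (expR (- s * x) * (f x - f 0)).
  by have dPx := dP x; refine (is_derive_eq _ _); field; rewrite gt_eqF.
have : P 0 + f 0 / s * expR (- s * 0) < P 1 + f 0 / s * expR (- s * 1).
  apply: (is_derive_lt ltr01 dD) => x /andP[x0 x1].
  by rewrite mulr_gt0 ?expR_gt0 // subr_gt0 f_mono // x0 ltW.
rewrite -(ltr_pM2l s0) mulr0 expR0 !mulr1 => PD.
rewrite -(pmulr_lgt0 _ (expR_gt0 (- s))).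
have : s * (P 0 + f 0 / s) = s * P 0 + f 0 by field; rewrite gt_eqF.
have : s * (P 1 + f 0 / s * expR (- s)) = s * P 1 + f 0 * expR (- s).
  by field; rewrite gt_eqF.
by have := f0E P dP; lra.
Qed.

Definition late_bid s tau x : R := expR (Num.max 0 (s * (x - tau))).

Lemma late_bid_continuous s tau : continuous (late_bid s tau).
Proof.
move=> x.
apply: (@continuous_comp _ _ _ (fun y => Num.max 0 (s * (y - tau))) expR).
  apply: (@continuous_max _ _ (fun=> 0) (fun y => s * (y - tau))).
    exact: cvg_cst.
  by apply: cvgMr; apply: cvgB; [exact: cvg_id|exact: cvg_cst].
exact: continuous_expR.
Qed.

Lemma late_bid_left s tau x : 0 < s -> x <= tau -> late_bid s tau x = 1.
Proof.
by move=> s0 xt; rewrite /late_bid max_l ?expR0 // pmulr_rle0 // subr_le0.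
Qed.

Lemma late_bid_right s tau x : 0 < s -> tau <= x ->
  late_bid s tau x = expR (s * (x - tau)).
Proof.
by move=> s0 tx; rewrite /late_bid max_r // pmulr_rge0 // subr_ge0.
Qed.

Lemma late_bid_ge1 s tau x : 1 <= late_bid s tau x.
Proof. by rewrite -[leLHS]expR0 ler_expR le_max lexx. Qed.

Lemma late_bid_gt0 s tau x : 0 < late_bid s tau x.
Proof. exact: expR_gt0. Qed.

Lemma late_bid_discounted s tau B : 0 < s -> 0 <= tau <= 1 ->
    discounted_primitive s (late_bid s tau) B ->
  B 1 - B 0 = (1 - expR (- s * tau)) / s + (1 - tau) * expR (- s * tau).
Proof.
move=> s0 /andP[tau0 tau1] dB.
have dE x := is_derive_discount x (lt0r_neq0 s0).
have head x : 0 < x < tau -> expR (- s * x) * late_bid s tau x = expR (- s * x).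
  by move=> /andP[_ xt]; rewrite late_bid_left ?mulr1 // ltW.
have dL x : is_derive x 1 (fun y => expR (- s * tau) * y) (expR (- s * tau)).
  by refine (is_derive_eq _ _); ring.
have tail x : tau < x < 1 ->
    expR (- s * x) * late_bid s tau x = expR (- s * tau).
  move=> /andP[tx _]; rewrite late_bid_right ?ltW // -expRD.
  by congr expR; ring.
have := is_derive_eq_sub tau0 (fun x _ => dB x) (fun x _ => dE x) head.
have := is_derive_eq_sub tau1 (fun x _ => dB x) (fun x _ => dL x) tail.
by rewrite mulr0 expR0 !mulr1; lra.
Qed.

Lemma late_bid_primitive s tau f x : 0 < s -> tau <= 1 -> 1 <= x ->
    (forall y, is_derive y 1 f (late_bid s tau y)) ->
  f x - f 1 = (expR (s * (x - tau)) - expR (s * (1 - tau))) / s.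
Proof.
move=> s0 tau1 x1 df.
have dE y :
    is_derive y 1 (fun z => expR (s * (z - tau)) / s) (expR (s * (y - tau))).
  by refine (is_derive_eq _ _); field; rewrite gt_eqF.
rewrite mulrBl.
apply: (is_derive_eq_sub x1 (fun y _ => df y) (fun y _ => dE y)).
by move=> y /andP[y1 _]; rewrite late_bid_right //; lra.
Qed.

Lemma initial_piece_ex s : 0 < s <= 1 -> exists f,
  [/\ delay_piece s f, forall x, is_derive x 1 f (late_bid s (tau_s s) x),
      f 1 = chi_s s & forall x, 1 <= x -> f x <= expR (s * (x - tau_s s)) / s].
Proof.
move=> s01; have /andP[s0 s1] := s01; have tau01 := tau_s_itv s01.
have cb := @late_bid_continuous s (tau_s s).
have [F dF] := continuous_primitive cb.
pose f x := F x - (F 1 - chi_s s).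
have df x : is_derive x 1 f (late_bid s (tau_s s) x).
  by rewrite -[late_bid _ _ _]subr0; exact: is_derive_subfun.
have f1 : f 1 = chi_s s by rewrite /f; ring.
exists f; split=> // [|x x1].
  have [B dB] := discounted_primitive_ex s cb.
  apply: (delay_piece_of_derivative s0 df (fun x _ => late_bid_gt0 _ _ x) dB).
  by rewrite (late_bid_discounted s0 tau01 dB) f1 chi_s_balance.
have /andP[_ tau1] := tau01; have := late_bid_primitive s0 tau1 x1 df.
have : s * chi_s s / s <= expR (s * (1 - tau_s s)) / s.
  by rewrite ler_pM2r ?invr_gt0 // chi_s_le.
by rewrite mulrAC divff ?gt_eqF // f1; lra.
Qed.

End InitialPiece.

Section UniformShift.
Context {R : realType}.
Implicit Types (n : int) (x w T v : R).
(* [B n x] is the bid of rank [n + x], [Q n x] the total of the bids up to it. *)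
Variables B Q : int -> R -> R.
Hypothesis cB : forall n, continuous (B n).
Hypothesis dQ : forall n x, is_derive x 1 (Q n) (B n x).
Hypothesis QS : forall n, Q (n + 1) 0 = Q n 1.
Hypothesis Q_ge0 : forall n, 0 <= Q n 1.
Hypothesis B_gt0 : forall n x, 0 <= x <= 1 -> 0 < B n x.
Hypothesis B_lt : forall n x, 0 < x < 1 -> B n x < B (n + 1) x.
Hypothesis B_small : forall T, 0 < T ->
  exists n, forall x, 0 < x < 1 -> B n x < T.

(* The junk value [1/2] is taken off (0, 1), a null set for the uniform law. *)
Definition shift_strategy w n : R := B n (if 0 < w < 1 then w else 2^-1).

Lemma shift_strategyE w n : 0 < w < 1 -> shift_strategy w n = B n w.
Proof. by move=> w01; rewrite /shift_strategy w01. Qed.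

Lemma shift_strategyP w : strategy (shift_strategy w).
Proof.
rewrite /shift_strategy; set x := if _ then _ else _.
have x01 : 0 < x < 1 by rewrite /x; case: ifP => // _; lra.
by split=> n; [apply: B_gt0; rewrite !ltW //; case/andP: x01|exact: B_lt].
Qed.

Lemma shift_rand_strategy : rand_strategy shift_strategy.
Proof.
split=> [|n]; first exact: shift_strategyP.
have mB : measurable_fun setT (B n) by exact: continuous_measurable_fun.
apply: (measurableT_comp mB); apply: measurable_fun_ifT => //.
by apply: measurable_and; exact: measurable_fun_ltr.
Qed.

Local Notation mu := (@lebesgue_measure R).
Local Notation I01 := (`]0%R, 1%R[%classic : set R).

Let I01P w : I01 w -> 0 < w < 1.
Proof. by rewrite /= in_itv. Qed.

Let I01_le1 w : I01 w -> 0 <= w <= 1.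
Proof. by move=> /I01P/andP[/ltW-> /ltW]. Qed.

Let mI01 : measurable I01.
Proof. exact: measurable_itv. Qed.

Lemma measurable_bid n (E : set R) : measurable_fun E (fun w => (B n w)%:E).
Proof.
by apply/measurable_EFinP/measurable_funTS; exact: continuous_measurable_fun.
Qed.

Lemma integral_bid n v : 0 <= v ->
  (\int[mu]_(x in `[0%R, v]) (B n x)%:E = (Q n v - Q n 0)%:E)%E.
Proof.
rewrite le_eqVlt => /predU1P[<-|v0].
  by rewrite set_itv1 integral_set1 subrr.
have cQ : continuous (Q n) := is_derive_continuous (dQ n).
rewrite (@continuous_FTC2 R (B n) (Q n) 0 v v0) //.
- exact: continuous_subspaceT.
- split.
  + by move=> x _; case: (dQ n x).
  + exact/cvg_at_right_filter/cQ.
  + exact/cvg_at_left_filter/cQ.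
- by move=> x _; rewrite derive1E; case: (dQ n x).
Qed.

Lemma telescope_spend n (k : nat) :
  \sum_(0 <= j < k) (Q (n - j%:Z) 1 - Q (n - j%:Z) 0) = Q n 1 - Q (n - k%:Z) 1.
Proof.
elim: k => [|k IHk]; first by rewrite big_geq // subr0 subrr.
rewrite big_nat_recr //= IHk -(QS (n - k.+1%:Z)).
by rewrite (_ : n - k.+1%:Z + 1 = n - k%:Z); [ring|lia].
Qed.

Lemma integral_bid_sum n :
  (\int[mu]_(w in I01) bid_sum (shift_strategy w) n <= (Q n 1)%:E)%E.
Proof.
have bid_ge0 (j : nat) w : I01 w -> (0 <= (B (n - j%:Z)%R w)%:E)%E.
  by move=> /I01_le1 w01; rewrite lee_fin ltW // B_gt0.
have -> : (\int[mu]_(w in I01) bid_sum (shift_strategy w) n =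
    \int[mu]_(w in I01) \sum_(j <oo) (B (n - j%:Z)%R w)%:E)%E.
  apply: eq_integral => w /set_mem/I01P w01.
  rewrite bid_sum_series; last exact: shift_strategyP.
  by apply: eq_eseriesr => j _; rewrite shift_strategyE.
rewrite integral_nneseries //; last by move=> j; exact: measurable_bid.
apply: lime_le.
  by apply: is_cvg_nneseries => j _ _; apply: integral_ge0 => w; exact: bid_ge0.
apply: nearW => k.
apply: (@le_trans _ _
    (\sum_(0 <= j < k) (Q (n - j%:Z)%R 1 - Q (n - j%:Z)%R 0)%:E)%E).
  apply: lee_sum => j _; rewrite -integral_bid ?ler01 //.
  apply: ge0_subset_integral => //; first exact: measurable_bid.
  by move=> x; rewrite /= in_itv /= => x01; rewrite lee_fin ltW // B_gt0.
by rewrite sumEFin lee_fin telescope_spend gerBl.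
Qed.

Lemma integral_bid_upto n v : 0 <= v <= 1 ->
  (\int[mu]_(w in I01) (if w <= v then B n w else 0)%:E <=
   (Q n v - Q n 0)%:E)%E.
Proof.
move=> /andP[v0 v1]; rewrite -integral_bid //.
have mv : measurable [set w : R | w <= v].
  by rewrite -[X in measurable X]setTI; exact: measurable_fun_ler.
have -> : (\int[mu]_(w in I01) (if w <= v then B n w else 0)%:E =
    \int[mu]_(w in I01 `&` [set w | (w <= v)%R]) (B n w)%:E)%E.
  rewrite integral_mkcondr; apply: eq_integral => w _; rewrite patchE.
  by case: ifPn => wv; [rewrite mem_set|rewrite memNset //; exact/negP].
apply: ge0_subset_integral => //.
- exact: measurableI.
- exact: measurable_bid.
- move=> x; rewrite /= in_itv /= => /andP[x0 xv].
  by rewrite lee_fin ltW // B_gt0 // x0 (le_trans xv).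
- by move=> w [/I01P /andP[w0 w1] /= wv]; rewrite in_itv /= wv ltW.
Qed.

Lemma shift_cost_le_bid_sum T w n : 0 < T -> 0 < w < 1 -> T <= B n w ->
  (cost (shift_strategy w) T <= bid_sum (shift_strategy w) n)%E.
Proof.
move=> T0 w01 Tn; have sw := shift_strategyP w; have [m mT] := B_small T0.
have [] := @is_nstar_ex _ (shift_strategy w) T n m sw.
  by rewrite !shift_strategyE // mT.
move=> k Tk; rewrite (costE Tk) bid_sum_le //.
by apply: Tk.2; rewrite shift_strategyE.
Qed.

Lemma shift_rand_cost T v n : 0 < T -> 0 <= v <= 1 ->
    (forall w, 0 < w < 1 -> v < w -> T <= B n w) ->
    (forall w, 0 < w < 1 -> T <= B (n + 1) w) ->
  (rand_cost (uniform_prob (@ltr01 R)) shift_strategy T <= (Q (n + 1) v)%:E)%E.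
Proof.
move=> T0 v01 T_le T_leS; have rs := shift_rand_strategy.
pose g w := (if w <= v then B (n + 1) w else 0)%:E.
have mg : measurable_fun setT g.
  apply/measurable_EFinP; apply: measurable_fun_ifT => //.
    exact: measurable_fun_ler.
  exact: continuous_measurable_fun.
have g0 w : I01 w -> (0 <= g w)%E.
  move=> /I01_le1 w01; rewrite /g; case: ifP => // _.
  by rewrite lee_fin ltW // B_gt0.
have cost_le w : I01 w ->
    (cost (shift_strategy w) T <= bid_sum (shift_strategy w) n + g w)%E.
  move=> /I01P w01; rewrite /g; have [wv|vw] := leP w v.
    have := shift_cost_le_bid_sum T0 w01 (T_leS w w01).
    by rewrite bid_sum_recr ?addrK ?shift_strategyE //; exact: shift_strategyP.
  by rewrite adde0; apply: shift_cost_le_bid_sum; rewrite ?T_le.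
have total_ge0 w : I01 w -> (0 <= bid_sum (shift_strategy w) n)%E.
  by move=> _; apply: bid_sum_ge0; exact: shift_strategyP.
have mcost := measurable_cost rs T; have mbid_sum := measurable_bid_sum rs n.
rewrite /rand_cost integral_uniform //; last first.
  by move=> w; apply: cost_ge0; exact: shift_strategyP.
rewrite subr0 invr1 mul1e integral_itv_bndoo; last exact: measurable_funTS.
apply: (@le_trans _ _
    (\int[mu]_(w in I01) (bid_sum (shift_strategy w) n + g w))%E).
  apply: ge0_le_integral => //.
  - by move=> w _; apply: cost_ge0; exact: shift_strategyP.
  - exact: measurable_funTS.
  - by apply: measurable_funTS; exact: emeasurable_funD.
rewrite ge0_integralD //; [|exact: measurable_funTS|exact: measurable_funTS].
have -> : (Q (n + 1) v)%:E = ((Q n 1)%:E + (Q (n + 1) v - Q (n + 1) 0)%:E)%E.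
  by rewrite -EFinD QS; congr EFin; ring.
by apply: leeD; [exact: integral_bid_sum|exact: integral_bid_upto].
Qed.

End UniformShift.

Section OptimalStrategy.
Context {R : realType}.
Implicit Types (x y v w T : R) (n : int) (k m : nat).
Variables (s : R) (f : nat -> R -> R).
Hypothesis s01 : 0 < s <= 1.
Hypothesis pieces : delay_pieces s f.
Hypothesis df0 : forall x, is_derive x 1 (f 0%N) (late_bid s (tau_s s) x).
Hypothesis f01 : f 0%N 1 = chi_s s.
Hypothesis f0_le : forall x, 1 <= x -> f 0%N x <= expR (s * (x - tau_s s)) / s.

Local Notation tau := (tau_s s).
Local Notation C := (delay_rate s).

Let s_gt0 : 0 < s. Proof. by case/andP: s01. Qed.
Let tau_ge0 : 0 <= tau. Proof. by case/andP: (tau_s_itv s01). Qed.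
Let tau_le1 : tau <= 1. Proof. by case/andP: (tau_s_itv s01). Qed.
Let C_gt0 : 0 < C. Proof. exact: delay_rate_gt0. Qed.

Let df k x : is_derive x 1 (f k.+1) (C * f k x).
Proof. by case: (pieces k). Qed.

Let f_glue k : f k.+1 1 = f k 0.
Proof. by case: (pieces k). Qed.

Let cf k : continuous (f k).
Proof. by case: (pieces k) => -[]. Qed.

Let f_gt0 k x : 0 <= x <= 1 -> 0 < f k x.
Proof. by case: (pieces k) => -[_ + _] _ _; apply. Qed.

Let f_at0_gt0 k : 0 < f k 0.
Proof. by rewrite f_gt0 // lexx ler01. Qed.

Lemma initial_piece_lt x y : x < y -> f 0%N x < f 0%N y.
Proof.
by move=> xy; apply: (is_derive_lt xy df0) => z _; exact: late_bid_gt0.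
Qed.

Lemma piece_lt k x y : 0 <= x -> x < y -> y <= 1 -> f k x < f k y.
Proof.
case: k => [|k] x0 xy y1; first exact: initial_piece_lt.
apply: (is_derive_lt xy (df k)) => z /andP[xz zy].
by rewrite mulr_gt0 // f_gt0 //; apply/andP; split; lra.
Qed.

Lemma piece_le k x y : 0 <= x -> x <= y -> y <= 1 -> f k x <= f k y.
Proof.
by move=> x0; rewrite le_eqVlt => /predU1P[->//|xy] y1; exact/ltW/piece_lt.
Qed.

Lemma bid_before0_le1 : C * f 0%N 1 <= 1.
Proof.
apply: (@le_trans _ _ (C * (expR (s * (1 - tau)) / s))).
  by rewrite ler_pM2l // f0_le.
have -> : C * (expR (s * (1 - tau)) / s) = expR (- s) * expR (s * (1 - tau)).
  by rewrite /delay_rate; field; rewrite gt_eqF.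
rewrite -expRD expR_le1; have : 0 <= s * tau by rewrite mulr_ge0 // ltW.
lra.
Qed.

(* [f j.+1] has slope at least [C * f j 0] on [0, 1], and these bounds decrease
   with [j]. *)
Lemma piece_decay k : k%:R * (C * f k 0) + f k 0 <= f 0%N 0.
Proof.
elim: k => [|k IHk]; first by rewrite mul0r add0r.
have [c /andP[c0 c1]] := is_derive_MVT ltr01 (fun x _ => df k x).
rewrite f_glue subr0 mulr1 => decrease.
have bid_ge : C * f k 0 <= C * f k c by rewrite ler_pM2l // piece_le // ltW.
have bid_gt0 : 0 < C * f k 0 by rewrite mulr_gt0.
have bid_decr : C * f k.+1 0 <= C * f k 0 by rewrite ler_pM2l //; lra.
have : k.+1%:R * (C * f k.+1 0) <= k.+1%:R * (C * f k 0) by rewrite ler_pM2l.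
move=> bids_le; apply: le_trans IHk; move: bids_le.
by rewrite -[k.+1%:R]natr1 !mulrDl; lra.
Qed.

Lemma bid_small T : 0 < T -> exists k, C * f k 0 < T.
Proof.
move=> T0; pose k := (Num.truncn (f 0%N 0 / T)).+1.
have kT : f 0%N 0 / T < k%:R := truncnS_gt _.
exists k; rewrite -(ltr_pM2l (ltr0Sn R _ : 0 < k%:R)).
apply: (@le_lt_trans _ _ (f 0%N 0)); last by rewrite -ltr_pdivrMr.
by have := piece_decay k; have := f_at0_gt0 k; lra.
Qed.

Definition optimal_bid n x : R := match n with
  | Posz m => late_bid s tau (x + m%:R) | Negz k => C * f k x end.

Definition optimal_spend n x : R := match n with
  | Posz m => f 0%N (x + m%:R) | Negz k => f k.+1 x end.

Let PoszS m : Posz m + 1 = Posz m.+1. Proof. lia. Qed.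
Let Negz0S : Negz 0 + 1 = Posz 0. Proof. lia. Qed.
Let NegzSS k : Negz k.+1 + 1 = Negz k. Proof. lia. Qed.

Lemma optimal_spend_Negz k x : optimal_spend (Negz k + 1) x = f k x.
Proof. by case: k => [|k]; rewrite ?Negz0S ?NegzSS //= addr0. Qed.

Lemma optimal_bid_continuous n : continuous (optimal_bid n).
Proof.
case: n => [m|k]; last by move=> x; apply: cvgMr; exact: cf.
have -> : optimal_bid (Posz m) = late_bid s (tau - m%:R).
  by apply/funext => x; rewrite /= /late_bid; congr (expR (Num.max 0 _)); ring.
exact: late_bid_continuous.
Qed.

Lemma is_derive_optimal_spend n x :
  is_derive x 1 (optimal_spend n) (optimal_bid n x).
Proof. by case: n => [m|k] /=; [exact: is_derive_comp_shift|exact: df]. Qed.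

Lemma optimal_spend_glue n : optimal_spend (n + 1) 0 = optimal_spend n 1.
Proof.
case: n => [m|k]; last by rewrite optimal_spend_Negz /= f_glue.
by rewrite PoszS /= add0r addrC natr1.
Qed.

Lemma optimal_spend_ge0 n : 0 <= optimal_spend n 1.
Proof.
case: n => [m|k] /=; last by rewrite f_glue ltW.
apply/ltW/(lt_trans (f_at0_gt0 0%N)).
by apply: initial_piece_lt; rewrite ltr_pwDl.
Qed.

Lemma optimal_bid_gt0 n x : 0 <= x <= 1 -> 0 < optimal_bid n x.
Proof.
move=> x01; case: n => [m|k] /=; first exact: late_bid_gt0.
by rewrite mulr_gt0 // f_gt0.
Qed.

Lemma optimal_bid_lt n x : 0 < x < 1 -> optimal_bid n x < optimal_bid (n + 1) x.
Proof.
move=> /andP[x0 x1]; case: n => [m|[|k]].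
- rewrite PoszS /= /late_bid ltr_expR -[m.+1%:R]natr1.
  have m0 : 0 <= m%:R :> R by [].
  have lt_tau : tau < x + (m%:R + 1) by apply: le_lt_trans tau_le1 _; lra.
  have grown : 0 < s * (x + (m%:R + 1) - tau) by rewrite mulr_gt0 // subr_gt0.
  by rewrite [ltRHS]max_r ?(ltW grown) // gt_max grown /= ltr_pM2l //; lra.
- rewrite Negz0S /=; apply: lt_le_trans (late_bid_ge1 _ _ _).
  by apply: lt_le_trans bid_before0_le1; rewrite ltr_pM2l // initial_piece_lt.
- rewrite NegzSS /= ltr_pM2l //; apply: (@lt_le_trans _ _ (f k 0)).
    by rewrite -f_glue piece_lt // ltW.
  by apply: piece_le => //; exact: ltW.
Qed.

Lemma optimal_bid_small T : 0 < T ->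
  exists n, forall x, 0 < x < 1 -> optimal_bid n x < T.
Proof.
move=> /bid_small[k kT]; exists (Negz k.+1) => x /andP[x0 x1] /=.
by apply: lt_trans kT; rewrite ltr_pM2l // -f_glue piece_lt // ltW.
Qed.

Definition optimal_strategy : R -> int -> R := shift_strategy optimal_bid.

Lemma optimal_rand_strategy : rand_strategy optimal_strategy.
Proof.
exact: (shift_rand_strategy optimal_bid_continuous
  optimal_bid_gt0 optimal_bid_lt).
Qed.

Local Notation optimal_cost :=
  (rand_cost (uniform_prob (@ltr01 R)) optimal_strategy).

Lemma optimal_cost_le T v n : 0 < T -> 0 <= v <= 1 ->
    (forall w, 0 < w < 1 -> v < w -> T <= optimal_bid n w) ->
    (forall w, 0 < w < 1 -> T <= optimal_bid (n + 1) w) ->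
  (optimal_cost T <= (optimal_spend (n + 1) v)%:E)%E.
Proof.
exact: (shift_rand_cost optimal_bid_continuous is_derive_optimal_spend
  optimal_spend_glue optimal_spend_ge0 optimal_bid_gt0 optimal_bid_lt
  optimal_bid_small).
Qed.

Lemma optimal_cost_le1 T : 0 < T <= 1 -> (optimal_cost T <= (chi_s s)%:E)%E.
Proof.
move=> /andP[T0 T1]; rewrite -f01 -(optimal_spend_Negz 0%N).
apply: optimal_cost_le => //; first by rewrite ler01 lexx.
  by move=> w /andP[_ w1] /ltW; rewrite leNgt w1.
by move=> w _; rewrite Negz0S; exact: le_trans (late_bid_ge1 _ _ _).
Qed.

Lemma optimal_cost_small T : 0 < T <= C * f 0%N 1 ->
  (optimal_cost T <= (rho_s s * T)%:E)%E.
Proof.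
move=> /andP[T0 T_le]; case: (ex_minnP (bid_small T0)) => k kT kmin.
have Tk : T <= C * f k 1.
  case: k kT kmin => [//|k] kT kmin; rewrite f_glue leNgt; apply/negP => /kmin.
  by rewrite ltnn.
have [||v] := @IVT R (fun x => C * f k x) 0 1 T ler01.
- by apply: continuous_subspaceT => x; apply: cvgMr; exact: cf.
- by rewrite ge_min le_max Tk (ltW kT) orbT.
rewrite in_itv /= => v01 vT; have /andP[v0 v1] := v01.
have -> : rho_s s * T = f k v.
  by rewrite -vT -[rho_s s]invrK -delay_rateE mulKf // gt_eqF.
rewrite -optimal_spend_Negz; apply: optimal_cost_le => // w /andP[w0 w1].
  by move=> vw; rewrite /= -vT ler_pM2l // piece_le // ltW.
apply: le_trans Tk _; case: k {kT kmin v vT v01 v0 v1} => [|k].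
  by rewrite Negz0S (le_trans bid_before0_le1) // late_bid_ge1.
by rewrite NegzSS /= f_glue ler_pM2l // piece_le // ltW.
Qed.

Lemma optimal_cost_large T : 1 < T -> (optimal_cost T <= (rho_s s * T)%:E)%E.
Proof.
move=> T1; have T0 : 0 < T by lra.
have lnT : 0 < ln T by rewrite ln_gt0.
pose t := tau + ln T / s.
have t_ge : tau <= t by rewrite lerDl divr_ge0 // ltW.
have /andP[mt tm] := truncn_itv (le_trans tau_ge0 t_ge).
set m := Num.truncn t in mt tm.
have T_le x : t <= x -> T <= late_bid s tau x.
  move=> tx; rewrite late_bid_right ?(le_trans t_ge) //.
  rewrite -[leLHS](@lnK _ T) ?posrE // ler_expR mulrC -ler_pdivrMr //.
  by move: tx; rewrite /t; lra.
have v01 : 0 <= t - m%:R <= 1.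
  by move: tm; rewrite -[m.+1%:R]natr1 subr_ge0 mt; lra.
apply: (@le_trans _ _ (optimal_spend (Posz m + 1) (t - m%:R))%:E).
  apply: optimal_cost_le => // w /andP[w0 w1]; rewrite ?PoszS /=.
    by move=> tw; apply: T_le; lra.
  by apply: T_le; lra.
have -> : optimal_spend (Posz m + 1) (t - m%:R) = f 0%N (t + 1).
  by rewrite PoszS /= -natr1; congr (f 0%N _); ring.
rewrite lee_fin; apply: le_trans (f0_le _) _.
  by rewrite lerDr (le_trans tau_ge0).
have -> : s * (t + 1 - tau) = s + ln T by rewrite /t; field; rewrite gt_eqF.
by rewrite expRD lnK ?posrE // /rho_s mulrAC.
Qed.

Lemma optimal_robust :
  robust (uniform_prob (@ltr01 R)) optimal_strategy (rho_s s).
Proof.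
move=> T T0; have [T_small|T_ge] := leP T (C * f 0%N 1).
  by apply: optimal_cost_small; rewrite T0.
have [T1|T1] := leP T 1; last exact: optimal_cost_large.
apply: le_trans (optimal_cost_le1 _) _; first by rewrite T0.
by rewrite lee_fin -f01 -[rho_s s]invrK -delay_rateE ler_pdivlMl // ltW.
Qed.

Lemma optimal_consistent :
  consistent (uniform_prob (@ltr01 R)) optimal_strategy (chi_s s).
Proof. by apply: optimal_cost_le1; rewrite ltr01 lexx. Qed.

End OptimalStrategy.

Lemma optimal_strategy_ex (R : realType) (s : R) : 0 < s <= 1 ->
  exists (d : measure_display) (Omega : measurableType d)
         (P : probability Omega R) (b : Omega -> int -> R),
    rand_strategy b /\ robust P b (rho_s s) /\ consistent P b (chi_s s).
Proof.
move=> s01; have /andP[s0 _] := s01.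
have [f0 [piece0 df0 f01 f0_le]] := initial_piece_ex s01.
have [f fE pieces] := delay_pieces_ex s0 piece0.
rewrite -{f0 piece0}fE in df0 f01 f0_le.
exists _, _, (uniform_prob (@ltr01 R)), (optimal_strategy s f).
split; first exact: optimal_rand_strategy.
by split; [exact: optimal_robust|exact: optimal_consistent].
Qed.

Theorem theorem1 (R : realType) (s : R) :
  0 < s <= 1 ->
  (exists (d : measure_display) (Omega : measurableType d)
          (P : probability Omega R) (b : Omega -> int -> R),
      rand_strategy b /\ robust P b (rho_s s) /\ consistent P b (chi_s s)) /\
  (forall rho' : R, rho' < rho_s s ->
     forall (d : measure_display) (Omega : measurableType d)
            (P : probability Omega R) (b : Omega -> int -> R),
       rand_strategy b -> robust P b rho' -> ~ consistent P b (chi_s s)).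
Proof.
move=> s01; split; first exact: optimal_strategy_ex.
by move=> rho' rho's d Omega P b; exact: no_better_robustness.
Qed.
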